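(* Let $f\in\mathcal{R}_1$, i.e. $f$ is analytic in $\mathbb{D}=\{z\in\mathbb{C}:|z|<1\}$ with Taylor expansion $f(z)=z+\sum_{n=2}^{\infty}a_nz^n$ and $\operatorname{Re}\left(f'(z)+zf''(z)\right)>0$ for all $z\in\mathbb{D}$. Then $$|H_3(1)(f^{-1})|\le \frac{1}{64}.$$ The result is sharp: equality holds for the function $f_\ast\in\mathcal{R}_1$ (normalized by $f_\ast(0)=0$, $f_\ast'(0)=1$) given by $$\left(zf_\ast'(z)\right)'=\frac{1+z^3}{1-z^3},\qquad z\in\mathbb{D}.$$
   Context: Let $\mathcal{A}$ be the class of analytic functions $f$ in the open unit disc $\mathbb{D}$ with Taylor expansion $f(z)=z+\sum_{n=2}^{\infty}a_nz^n$. Define $\mathcal{R}_1=\{f\in\mathcal{A}:\operatorname{Re}\left(f'(z)+zf''(z)\right)>0,\ z\in\mathbb{D}\}$; equivalently $\operatorname{Re}\left((zf'(z))'\right)>0$ in $\mathbb{D}$. Members of $\mathcal{R}_1$ are univalent in $\mathbb{D}$. For univalent $f\in\mathcal{A}$, the inverse function has an expansion $f^{-1}(w)=w+\sum_{n=2}^{\infty}A_nw^n$ near $w=0$ (valid at least in a disc of radius $1/4$). The third Hankel determinant of the inverse coefficients is, with $A_1=1$, $$H_3(1)(f^{-1})=\det\begin{pmatrix} 1 & A_2 & A_3 \\ A_2 & A_3 & A_4 \\ A_3 & A_4 & A_5 \end{pmatrix}=2A_2A_3A_4-A_3^3-A_4^2+A_3A_5-A_2^2A_5.$$ *)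

(* Defs.v *)
From Stdlib Require Import Reals.
From Coquelicot Require Import Coquelicot.
Open Scope R_scope.

Definition unit_disc (z : C) : Prop := Cmod z < 1.

(* [is_normalized_pseries a r f]: f(z) = z + sum_(n >= 2) a_n z^n, as a
   convergent series, for |z| < r; in particular f is analytic there. *)
Definition is_normalized_pseries (a : nat -> C) (r : R) (f : C -> C) : Prop :=
  a 0%nat = 0%C /\ a 1%nat = 1%C /\
  forall z : C, Cmod z < r -> @is_pseries C_AbsRing C_NormedModule a z (f z).

(* Functions are total on [C]; only the values on the unit disc matter.  The
   library's [C_derive] is a total operator, which is the complex derivative
   wherever the latter exists, hence for f and f' on the unit disc below. *)
Definition class_A (f : C -> C) : Prop :=
  exists a : nat -> C, is_normalized_pseries a 1 f.

Definition class_R1 (f : C -> C) : Prop :=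
  class_A f /\
  forall z : C, unit_disc z ->
    0 < Re (C_derive f z + z * C_derive (C_derive f) z)%C.

(* A_n are the coefficients of the expansion at 0 of the inverse function
   g : f(D) -> D of f, D being the unit disc.  The second clause says that the
   disc |w| < r, on which the expansion holds, lies in f(D).  For f in
   [class_A] and univalent in D, such A exists and is unique. *)
Definition inverse_coefficients (f : C -> C) (A : nat -> C) : Prop :=
  exists (g : C -> C) (r : R),
    (forall z : C, unit_disc z -> g (f z) = z) /\
    0 < r /\
    (forall w : C, Cmod w < r -> unit_disc (g w) /\ f (g w) = w) /\
    is_normalized_pseries A r g.

Definition det3 (m : nat -> nat -> C) : C :=
  (m 0%nat 0%nat * (m 1%nat 1%nat * m 2%nat 2%nat - m 1%nat 2%nat * m 2%nat 1%nat)
   - m 0%nat 1%nat * (m 1%nat 0%nat * m 2%nat 2%nat - m 1%nat 2%nat * m 2%nat 0%nat)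
   + m 0%nat 2%nat * (m 1%nat 0%nat * m 2%nat 1%nat - m 1%nat 1%nat * m 2%nat 0%nat))%C.

Definition Hankel3 (A : nat -> C) : C := det3 (fun i j => A (S (i + j))).

(* (z f'(z))' = (1 + z^3) / (1 - z^3) on the unit disc, f normalized. *)
Definition extremal (f : C -> C) : Prop :=
  class_A f /\
  forall z : C, unit_disc z ->
    C_derive (fun u : C => u * C_derive f u)%C z
    = ((1 + z * z * z) / (1 - z * z * z))%C.

Lemma Hankel3E (A : nat -> C) : A 1%nat = 1%C ->
  Hankel3 A =
  (2 * A 2%nat * A 3%nat * A 4%nat - A 3%nat * A 3%nat * A 3%nat
   - A 4%nat * A 4%nat + A 3%nat * A 5%nat
   - A 2%nat * A 2%nat * A 5%nat)%C.
Proof. intros H. unfold Hankel3, det3; simpl. rewrite H. ring. Qed.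

(* Main.v *)
Require Import Defs.
From Stdlib Require Import Reals.
From Coquelicot Require Import Coquelicot.
From Stdlib Require Import Lra Lia Psatz ClassicalEpsilon.
Open Scope R_scope.

(* The function p = f' + z f'' has positive real part and p(0) = 1, and its
   coefficients 2 C_n satisfy (n + 1)^2 a_(n+1) = 2 C_n.  Averaging
   p |q|^2 over roots of unity, for q a polynomial of degree at most 4, shows that the
   5 x 5 Toeplitz form of (1, C_1, ..., C_4) is nonnegative; evaluated at the reversed
   Szego polynomials it gives Schur parameters a, x, y, w in the closed unit disc.  In
   these, with s = 1 - |a|^2, the determinant is
     h0 + (1 - |x|^2) (h1 y + h2 y^2 + h3 (1 - |y|^2) w),
   where the h_i depend on a and x only.  Once the powers of s in h0 are made homogeneous by means
   of s + |a|^2 = 1, bounding each monomial by its modulus is enough for 1/64.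
   Equality in the extremal case comes from a_2 = a_3 = a_5 = 0, a_4 = 1/8.
   Functions of R_1 are univalent because Re f' > 0, and the inverse series is obtained by
   Picard iteration. *)

(** Schur parameters replace the interlocking Toeplitz constraints on C_1, ..., C_4 by four
    independent conditions of modulus at most 1, and w enters through a_5 only, hence linearly. A
    crude termwise estimate can be sharp because the majorant reaches 1/64 only at a = x = 0, |y| =
    1. There a single monomial survives; it comes from a_4^2 with a_4 = C_3 / 8, whence (1/8)^2.
    Everywhere else there is room to spare. The function theory rests on power series alone. Means
    over roots of unity, exact on polynomials of low degree, take the place of contour integrals.
    They yield the Toeplitz inequality and Cauchy's estimate; the latter yields Weierstrass' theorem
    on locally uniform limits, which in turn makes products, compositions and the Picard limit
    analytic. *)

(** * The inverse Hankel determinant in Schur parameters *)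

(* Only the real part matters: it is the Hermitian form of the Toeplitz matrix with
   first row 1, c 1, c 2, c 3, c 4. *)
Definition toeplitz (c : nat -> C) (v0 v1 v2 v3 v4 : C) : C :=
  (v0 * Cconj v0 + v1 * Cconj v1 + v2 * Cconj v2 + v3 * Cconj v3 + v4 * Cconj v4
   + 2 * (c 1%nat * (v0 * Cconj v1 + v1 * Cconj v2 + v2 * Cconj v3 + v3 * Cconj v4)
   + c 2%nat * (v0 * Cconj v2 + v1 * Cconj v3 + v2 * Cconj v4)
   + c 3%nat * (v0 * Cconj v3 + v1 * Cconj v4)
   + c 4%nat * (v0 * Cconj v4)))%C.

(** Turns a claim about a real part into a polynomial identity between complex numbers and their
    conjugates, which [ring] decides. *)
Lemma Re_eq_of_conj (z : C) (r : R) : (z + Cconj z = 2 * r)%C -> Re z = r.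
Proof.
  intros H. apply (f_equal Re) in H. rewrite re_plus, re_conj in H.
  rewrite <- RtoC_mult, re_RtoC in H. lra.
Qed.

Lemma Cconj_RtoC (r : R) : Cconj r = r.
Proof. unfold Cconj, RtoC; simpl. f_equal; ring. Qed.

Ltac push_conj := repeat (progress rewrite ?Cplus_conj, ?Cminus_conj, ?Cmult_conj, ?Copp_conj, ?Cpow_conj, ?Cconj_conj, ?Cconj_RtoC).

Lemma Cmod_sqr (z : C) : RtoC (Cmod z ^ 2) = (z * Cconj z)%C.
Proof. apply Cmod2_conj. Qed.

(** Schur's parametrization of a Caratheodory sequence. Each new parameter enters the next
    coefficient linearly, with the product of the preceding factors 1 - |parameter|^2 in front, so
    it can be solved for as long as these do not vanish. *)
Definition schur_coefficients (c : nat -> C) (a x y w : C) : Prop :=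
  let a' := Cconj a in let x' := Cconj x in let y' := Cconj y in
  let s := (1 - a * a')%C in
  (c 1%nat = a /\
  c 2%nat = a * a + s * x /\
  c 3%nat = a * a * a + 2 * s * a * x - s * a' * x * x + s * (1 - x * x') * y /\
  c 4%nat = a * a * a * a + s * x * (3 * a * a - 3 * a * a' * x + a' * a' * x * x + x)
    - s * (1 - x * x') * (2 * (a' * x - a) * y + x' * y * y - (1 - y * y') * w))%C.

(** In this and the three companion evaluations the vector lists the coefficients of a reversed
    Szego polynomial. They arise from 1 by the recursion Q_(n+1) = Q_n - t z P_n, where P_n is the
    reversal of Q_n with conjugated coefficients and t runs through a, x, y, w. Each step multiplies
    the squared norm by 1 - |t|^2. *)
Lemma Re_toeplitz_szego1 c a : c 1%nat = a ->
  Re (toeplitz c 1 (- a) 0 0 0) = 1 - Cmod a ^ 2.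
Proof.
  intros H1. apply Re_eq_of_conj. rewrite RtoC_minus, Cmod_sqr. unfold toeplitz.
  rewrite H1. push_conj. ring.
Qed.
Lemma Re_toeplitz_szego4 c a x y w : schur_coefficients c a x y w ->
  Re (toeplitz c 1 (x * Cconj a - a + y * Cconj x + w * Cconj y)
     (- x - y * (Cconj x * a - Cconj a) + w * (Cconj x + Cconj y * (x * Cconj a - a)))
     (- y - w * (Cconj x * a - Cconj a + Cconj y * x))
     (-w))%C = (1 - Cmod a ^ 2) * (1 - Cmod x ^ 2) * (1 - Cmod y ^ 2) * (1 - Cmod w ^ 2).
Proof.
  intros (H1 & H2 & H3 & H4). apply Re_eq_of_conj. rewrite !RtoC_mult, !RtoC_minus, !Cmod_sqr. unfold toeplitz.
  rewrite H1, H2, H3, H4. push_conj. ring.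
Qed.

(** The budget 1/64 is split into S^2 / 64 and (1 - S^2) / 64 = T^2 (1 + S) / 64. Terms with a
    factor T^2 are charged to the second share ([R0]), the remaining ones carry S^2 and are charged
    to the first ([R2]). The only tight spot is T = X = 0, Y = 1. *)
Lemma hankel_majorant_le (T X Y : R) : 0 <= T <= 1 -> 0 <= X <= 1 -> 0 <= Y <= 1 ->
  let S := 1 - T ^ 2 in let D := 2 / 9 * S * X + T ^ 2 / 36 in
  76 / 18225 * S ^ 3 * X ^ 3 + 1493 / 97200 * T ^ 2 * S ^ 2 * X ^ 2 + 1 / 1200 * T ^ 2 * S ^ 2 * X ^ 3
  + 31 / 14400 * T ^ 2 * S ^ 2 * X ^ 4 + 29 / 19440 * T ^ 4 * S * X + 19 / 2400 * T ^ 4 * S * X ^ 2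
  + 1 / 450 * T ^ 4 * S * X ^ 3 + 149 / 145800 * T ^ 6
  + (1 - X ^ 2) * ((1 / 1200 * T * S ^ 2 * X + 31 / 7200 * T * S ^ 2 * X ^ 2 + 19 / 2400 * T ^ 3 * S
       + 1 / 225 * T ^ 3 * S * X) * Y
     + S * (S * (1 - X ^ 2) / 64 + 2 / 25 * X * D) * Y ^ 2 + 2 / 25 * S * D * (1 - Y ^ 2)) <= 1 / 64.
Proof.
  intros HT HX HY S D.
  assert (HB : 0 <= T ^ 2 <= 1) by nra.
  assert (HS : S = 1 - T ^ 2) by reflexivity. assert (HD : D = 2 / 9 * S * X + T ^ 2 / 36) by reflexivity.
  clearbody S D.
  assert (E4 : T ^ 4 = (T ^ 2) ^ 2) by ring. assert (E6 : T ^ 6 = (T ^ 2) ^ 3) by ring.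
  assert (Q1 : T * X <= (T ^ 2 + X ^ 2) / 2) by (pose proof (pow2_ge_0 (T - X)); lra).
  assert (Q3 : 0 <= T ^ 3 <= T ^ 2) by (split; [apply pow_le; lra | nra]).
  rewrite E4, E6. clear E4 E6. set (B := T ^ 2) in *. clearbody B. set (T3 := T ^ 3) in *. clearbody T3.
  assert (HS1 : 0 <= S <= 1) by lra.
  assert (HU : 0 <= X ^ 2 <= 1) by nra.
  (* Odd powers of T are traded for [B] or X^2, and 1/80 covers 19/2400 + 1/225. *)
  assert (P1 : (1 / 1200 * T * S ^ 2 * X + 31 / 7200 * T * S ^ 2 * X ^ 2 + 19 / 2400 * T3 * S
       + 1 / 225 * T3 * S * X) * Y <= S ^ 2 * (B + X ^ 2) / 2400 + 31 / 7200 * S ^ 2 * X ^ 2 + B * S * (1 / 80)).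
  { assert (Q2 : T * X ^ 2 <= X ^ 2) by nra.
    assert (Q4 : T3 * X <= B) by nra.
    assert (HS2 : 0 <= S ^ 2) by nra.
    assert (E : 0 <= 1 / 1200 * T * S ^ 2 * X + 31 / 7200 * T * S ^ 2 * X ^ 2 + 19 / 2400 * T3 * S
       + 1 / 225 * T3 * S * X).
    { repeat apply Rplus_le_le_0_compat; repeat apply Rmult_le_pos; lra. }
    apply Rle_trans with (1 / 1200 * T * S ^ 2 * X + 31 / 7200 * T * S ^ 2 * X ^ 2 + 19 / 2400 * T3 * S
       + 1 / 225 * T3 * S * X); [nra|].
    assert (E1 := Rmult_le_compat_l _ _ _ HS2 Q1).
    assert (E2 := Rmult_le_compat_l _ _ _ HS2 Q2).
    assert (E3 := Rmult_le_compat_l _ _ _ (proj1 HS1) (proj2 Q3)).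
    assert (E4 := Rmult_le_compat_l _ _ _ (proj1 HS1) Q4).
    nra. }
  (* Powers of X are dropped here and lowered to X^2 in [P3]; the coefficients are then added and
     rounded up. For instance 3/250 covers 29/19440 + 19/2400 + 1/450, and 1/230 covers 76/18225. *)
  assert (P2 : 29 / 19440 * B ^ 2 * S * X + 19 / 2400 * B ^ 2 * S * X ^ 2
  + 1 / 450 * B ^ 2 * S * X ^ 3 + 149 / 145800 * B ^ 3 <= B * (B * S * (3 / 250) + B ^ 2 * (3 / 2500))).
  { assert (0 <= B ^ 2 * S) by (apply Rmult_le_pos; nra).
    assert (X ^ 2 <= 1) by nra. assert (X ^ 3 <= 1) by nra.
    assert (0 <= B ^ 3) by (apply pow_le; lra).
    nra. }
  assert (P3 : 76 / 18225 * S ^ 3 * X ^ 3 + 1493 / 97200 * B * S ^ 2 * X ^ 2 + 1 / 1200 * B * S ^ 2 * X ^ 3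
  + 31 / 14400 * B * S ^ 2 * X ^ 4 <= S ^ 2 * (X ^ 2 * (1 / 230)) + B * S ^ 2 * (X ^ 2 * (2 / 100))).
  { assert (0 <= S ^ 2) by nra.
    assert (S ^ 3 <= S ^ 2) by nra. assert (X ^ 3 <= X ^ 2) by nra. assert (X ^ 4 <= X ^ 2) by nra.
    assert (0 <= X ^ 3) by (apply pow_le; lra). 
    assert (0 <= B * S ^ 2) by nra.
    assert (S ^ 3 * X ^ 3 <= S ^ 2 * X ^ 2) by (apply Rmult_le_compat; try lra; apply pow_le; lra).
    nra. }
  set (A2 := S * (S * (1 - X ^ 2) / 64 + 2 / 25 * X * D)) in *. set (A3 := 2 / 25 * S * D) in *.
  assert (HY2 : 0 <= Y ^ 2 <= 1) by nra.
  (* Y^2 and 1 - Y^2 are convex weights, so the extreme cases Y = 1 and Y = 0 decide; only [A2]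
     contains the critical S^2 / 64. *)
  assert (HM : forall m, A2 <= m -> A3 <= m -> A2 * Y ^ 2 + A3 * (1 - Y ^ 2) <= m) by (intros m ? ?; nra).
  assert (HS2 : 0 <= S ^ 2) by nra.
  assert (HA2 : A2 <= S ^ 2 * (1 - X ^ 2) / 64 + 8 / 450 * S ^ 2 * X ^ 2 + S * B / 450).
  { assert (0 <= S * B * (1 - X)) by (repeat apply Rmult_le_pos; lra).
    unfold A2. rewrite HD. nra. }
  assert (HA3 : A3 <= 8 / 450 * S ^ 2 * X + S * B / 450) by (unfold A3; rewrite HD; right; field).
  (* The true maximum is 2 / (3 sqrt 3), about 0.385. The nonnegative cubic X (X - 1/2)^2 reduces
     the claim to a quadratic one. *)
  assert (HX3 : X * (1 - X ^ 2) <= 2 / 5).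
  { assert (0 <= X * (X - 1 / 2) ^ 2) by (apply Rmult_le_pos; [lra | apply pow2_ge_0]).
    pose proof (pow2_ge_0 (X - 5 / 8)). lra. }
  set (u := X ^ 2) in *. set (m := A2 * Y ^ 2 + A3 * (1 - Y ^ 2)) in *.
  assert (R0 : B * (B * S * (3 / 250) + B ^ 2 * (3 / 2500)) + B * S ^ 2 * (u * (2 / 100))
     + (1 - u) * (S ^ 2 * B / 2400 + B * S * (1 / 80) + S * B / 450) <= (1 - S ^ 2) / 64).
  { assert (0 <= u * S * (1 - S)) by (repeat apply Rmult_le_pos; lra).
    assert (0 <= (1 - u) * S * (1 - S)) by (repeat apply Rmult_le_pos; lra).
    assert (W : B * S * (3 / 250) + B ^ 2 * (3 / 2500) + S ^ 2 * (u * (2 / 100))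
     + (1 - u) * (S ^ 2 / 2400 + S * (1 / 80) + S / 450) <= (1 + S) / 64).
    { assert (B * S <= 1 / 4) by (rewrite HS; pose proof (pow2_ge_0 (B - 1 / 2)); lra).
      assert (B ^ 2 <= 1) by nra. assert (0 <= u * S) by (apply Rmult_le_pos; lra). nra. }
    assert (W' := Rmult_le_compat_l _ _ _ (proj1 HB) W).
    replace (1 - S ^ 2) with (B * (1 + S)) by (rewrite HS; ring). lra. }
  assert (R1 : m <= S ^ 2 * (1 - u) / 64 + 8 / 450 * S ^ 2 * u + S * B / 450 \/ m <= 8 / 450 * S ^ 2 * X + S * B / 450).
  { destruct (Rle_dec A2 A3); [right | left]; apply HM; lra. }
  assert (R2 : (1 - u) * (S ^ 2 * u / 2400 + 31 / 7200 * S ^ 2 * u) + S ^ 2 * (u * (1 / 230))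
    + (1 - u) * (m - S * B / 450) <= S ^ 2 / 64).
  { destruct R1 as [R1 | R1].
    - assert ((1 - u) * (m - S * B / 450) <= (1 - u) * (S ^ 2 * (1 - u) / 64 + 8 / 450 * S ^ 2 * u))
        by (apply Rmult_le_compat_l; lra).
      assert (K : (1 - u) * (u / 2400 + 31 / 7200 * u) + u / 230 + (1 - u) * ((1 - u) / 64 + 8 / 450 * u) <= 1 / 64) by nra.
      assert (K' := Rmult_le_compat_l _ _ _ HS2 K). lra.
    - assert ((1 - u) * (m - S * B / 450) <= (1 - u) * (8 / 450 * S ^ 2 * X))
        by (apply Rmult_le_compat_l; lra).
      assert (K : (1 - u) * (u / 2400 + 31 / 7200 * u) + u / 230 + 8 / 450 * (X * (1 - u)) <= 1 / 64) by nra.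
      assert (K' := Rmult_le_compat_l _ _ _ HS2 K). lra. }
  assert (R3 := Rmult_le_compat_l (1 - u) _ _ ltac:(lra) P1).
  rewrite Rplus_assoc with (r1 := _ * Y). fold m.
  assert (R4 := Rmult_plus_distr_l (1 - u)
    ((1 / 1200 * T * S ^ 2 * X + 31 / 7200 * T * S ^ 2 * u + 19 / 2400 * T3 * S + 1 / 225 * T3 * S * X) * Y) m).
  rewrite R4. clear R4. clearbody m A2 A3. lra.
Qed.

(* H_3(1) of f minus (a_3 - a_2^2)^3, where (n + 1)^2 a_(n+1) = 2 c_n. *)
Definition inverse_hankel (c : nat -> C) : C :=
  let a2 := (c 1%nat / 2)%C in let a3 := (2 * c 2%nat / 9)%C in
  let a4 := (c 3%nat / 8)%C in let a5 := (2 * c 4%nat / 25)%C in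
  (2 * a2 * a3 * a4 - a3 * a3 * a3 - a4 * a4 + (a3 - a2 * a2) * a5
   - (a3 - a2 * a2) * (a3 - a2 * a2) * (a3 - a2 * a2))%C.

Ltac Cmod_simpl := rewrite ?Cmod_mult, ?Cmod_pow, ?Cmod_conj, ?Cmod_opp, ?Cmod_R.

Lemma Cmod_triangle_le (z1 z2 : C) (r1 r2 : R) : Cmod z1 <= r1 -> Cmod z2 <= r2 -> Cmod (z1 + z2) <= r1 + r2.
Proof. intros. eapply Rle_trans; [apply Cmod_triangle | lra]. Qed.

Lemma RtoC_neq (r1 r2 : R) : r1 <> r2 -> RtoC r1 <> RtoC r2.
Proof. intros H E. apply RtoC_inj in E. auto. Qed.

Ltac Cneq := apply RtoC_neq; lra.
Ltac Cfield := field; repeat split; Cneq.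

Lemma inverse_hankel_le (c : nat -> C) (a x y w : C) :
  schur_coefficients c a x y w -> Cmod a <= 1 -> Cmod x <= 1 -> Cmod y <= 1 -> Cmod w <= 1 ->
  Cmod (inverse_hankel c) <= 1 / 64.
Proof.
  intros (H1 & H2 & H3 & H4) Ha Hx Hy Hw.
  set (S := 1 - Cmod a ^ 2). set (U := 1 - Cmod x ^ 2). set (V := 1 - Cmod y ^ 2).
  assert (HS : RtoC S = (1 - a * Cconj a)%C) by (unfold S; now rewrite RtoC_minus, Cmod_sqr).
  assert (HU : RtoC U = (1 - x * Cconj x)%C) by (unfold U; now rewrite RtoC_minus, Cmod_sqr).
  assert (HV : RtoC V = (1 - y * Cconj y)%C) by (unfold V; now rewrite RtoC_minus, Cmod_sqr).
  (* This is a_3 - a_2^2, the factor of a_5 in the determinant, and hence also the factor of w. *)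
  set (D := (RtoC (2 / 9) * S * x + RtoC (- (1 / 36)) * a ^ 2)%C).
  (* The eight monomials before [U] have total degree 3 in S and |a|^2 once moduli are taken: terms
     of opposite sign with different powers of s have been merged beforehand. Rotations of the disc
     give a, x, y, w the weights 1, 2, 3, 4, conjugates counting negatively, and every monomial has
     weight 6. *)
  assert (E : inverse_hankel c =
    (RtoC (- (76 / 18225)) * S ^ 3 * x ^ 3 + RtoC (1493 / 97200) * a ^ 2 * S ^ 2 * x ^ 2
     + RtoC (- (1 / 1200)) * (a * Cconj a) * S ^ 2 * x ^ 3 + RtoC (31 / 14400) * Cconj a ^ 2 * S ^ 2 * x ^ 4
     + RtoC (- (29 / 19440)) * a ^ 4 * S * x + RtoC (19 / 2400) * (a ^ 3 * Cconj a) * S * x ^ 2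
     + RtoC (- (1 / 450)) * (a ^ 2 * Cconj a ^ 2) * S * x ^ 3 + RtoC (- (149 / 145800)) * a ^ 6
     + U * ((RtoC (1 / 1200) * a * S ^ 2 * x + RtoC (- (31 / 7200)) * Cconj a * S ^ 2 * x ^ 2
             + RtoC (- (19 / 2400)) * a ^ 3 * S + RtoC (1 / 225) * (a ^ 2 * Cconj a) * S * x) * y
        + RtoC (- 1) * S * (RtoC (1 / 64) * (S * U) + RtoC (2 / 25) * Cconj x * D) * y ^ 2
        + RtoC (2 / 25) * S * D * (V * w)))%C).
  { unfold inverse_hankel, D. rewrite H1, H2, H3, H4, HS, HU, HV. clear.
    rewrite ?RtoC_opp, !RtoC_div by lra. Cfield. }
  assert (HT := conj (Cmod_ge_0 a) Ha). assert (HX := conj (Cmod_ge_0 x) Hx). assert (HY := conj (Cmod_ge_0 y) Hy).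
  assert (HB := hankel_majorant_le _ _ _ HT HX HY). cbv zeta in HB. fold S in HB.
  eapply Rle_trans; [|exact HB]. rewrite E. clear E HB H1 H2 H3 H4.
  assert (PS : Rabs S = S) by (apply Rabs_pos_eq; unfold S; nra).
  assert (PU : Rabs U = U) by (apply Rabs_pos_eq; unfold U; nra).
  assert (PV : Rabs V = V) by (apply Rabs_pos_eq; unfold V; nra).
  assert (DD : Cmod D <= 2 / 9 * S * Cmod x + Cmod a ^ 2 / 36).
  { unfold D. apply Cmod_triangle_le; Cmod_simpl; rewrite ?PS, ?Rabs_Ropp, ?Rabs_pos_eq by lra; lra. }
  repeat apply Cmod_triangle_le.
  1-8: Cmod_simpl; rewrite ?PS, ?Rabs_Ropp, ?Rabs_pos_eq by lra; apply Req_le; ring.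
  rewrite Cmod_mult, Cmod_R, PU. apply Rmult_le_compat_l; [unfold U; nra|].
  repeat apply Cmod_triangle_le.
  - rewrite Cmod_mult. apply Rmult_le_compat_r; [lra|].
    repeat apply Cmod_triangle_le; Cmod_simpl; rewrite ?PS, ?Rabs_Ropp, ?Rabs_pos_eq by lra; apply Req_le; ring.
  - rewrite 3!Cmod_mult, Cmod_pow, !Cmod_R, PS, Rabs_m1, Rmult_1_l.
    apply Rmult_le_compat_r; [nra|]. apply Rmult_le_compat_l; [unfold S; nra|].
    apply Cmod_triangle_le; Cmod_simpl; rewrite ?PS, ?PU, ?Rabs_pos_eq by lra.
    + unfold U. right; field.
    + apply Rmult_le_compat_l; [nra | exact DD].
  - Cmod_simpl. rewrite PS, PV, Rabs_pos_eq by lra. fold V.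
    assert (0 <= V) by (unfold V; nra). assert (0 <= S) by (unfold S; nra).
    apply Rmult_le_compat.
    + repeat apply Rmult_le_pos; try lra. apply Cmod_ge_0.
    + apply Rmult_le_pos; [lra | apply Cmod_ge_0].
    + apply Rmult_le_compat_l; [nra | exact DD].
    + nra.
Qed.

Lemma Re_toeplitz_szego2 c a x : c 1%nat = a -> (c 2%nat = a * a + (1 - a * Cconj a) * x)%C ->
  Re (toeplitz c 1 (x * Cconj a - a)%C (- x)%C 0 0) = (1 - Cmod a ^ 2) * (1 - Cmod x ^ 2).
Proof.
  intros H1 H2. apply Re_eq_of_conj. rewrite !RtoC_mult, !RtoC_minus, !Cmod_sqr. unfold toeplitz.
  rewrite H1, H2. push_conj. ring.
Qed.

Lemma Re_toeplitz_szego3 c a x y : c 1%nat = a -> (c 2%nat = a * a + (1 - a * Cconj a) * x)%C ->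
  (c 3%nat = a * a * a + 2 * (1 - a * Cconj a) * a * x - (1 - a * Cconj a) * Cconj a * x * x
    + (1 - a * Cconj a) * (1 - x * Cconj x) * y)%C ->
  Re (toeplitz c 1 (x * Cconj a - a + y * Cconj x)%C (- x - y * (Cconj x * a - Cconj a))%C (- y)%C 0)
  = (1 - Cmod a ^ 2) * (1 - Cmod x ^ 2) * (1 - Cmod y ^ 2).
Proof.
  intros H1 H2 H3. apply Re_eq_of_conj. rewrite !RtoC_mult, !RtoC_minus, !Cmod_sqr. unfold toeplitz.
  rewrite H1, H2, H3. push_conj. ring.
Qed.

(* The form is evaluated at the coefficients of the reversed Szego polynomials, where
   it is a product of factors 1 - |parameter|^2; positivity of e keeps these factors
   away from 0. *)
Lemma toeplitz_schur (c : nat -> C) (e : R) : 0 < e ->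
  (forall v1 v2 v3 v4 : C, e <= Re (toeplitz c 1 v1 v2 v3 v4)) ->
  exists a x y w : C, schur_coefficients c a x y w /\
    Cmod a <= 1 /\ Cmod x <= 1 /\ Cmod y <= 1 /\ Cmod w <= 1.
Proof.
  intros He HT.
  assert (Hlt : forall z r, 0 < r -> e <= r * (1 - Cmod z ^ 2) -> Cmod z <= 1 /\ 0 < 1 - Cmod z ^ 2).
  { intros z r Hr H. pose proof (Cmod_ge_0 z).
    assert (0 < 1 - Cmod z ^ 2) by (destruct (Rlt_dec 0 (1 - Cmod z ^ 2)); [assumption | nra]).
    split; nra. }
  assert (Hnz : forall z, 0 < 1 - Cmod z ^ 2 -> (1 - z * Cconj z)%C <> 0).
  { intros z H. rewrite <- Cmod_sqr, <- RtoC_minus. apply RtoC_neq. lra. }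
  set (a := c 1%nat).
  assert (T1 := HT (- a)%C 0 0 0). rewrite (Re_toeplitz_szego1 c a eq_refl), <- (Rmult_1_l (1 - _)) in T1.
  destruct (Hlt _ _ Rlt_0_1 T1) as [Ha Ha']. assert (Na := Hnz _ Ha').
  set (x := ((c 2%nat - a * a) / (1 - a * Cconj a))%C).
  assert (H2 : (c 2%nat = a * a + (1 - a * Cconj a) * x)%C) by (unfold x; field; exact Na).
  clearbody x.
  assert (T2 := HT (x * Cconj a - a)%C (- x)%C 0 0). rewrite (Re_toeplitz_szego2 c a x eq_refl H2) in T2.
  destruct (Hlt _ _ Ha' T2) as [Hx Hx']. assert (Nx := Hnz _ Hx').
  set (y := ((c 3%nat - (a * a * a + 2 * (1 - a * Cconj a) * a * x - (1 - a * Cconj a) * Cconj a * x * x))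
     / ((1 - a * Cconj a) * (1 - x * Cconj x)))%C).
  assert (H3 : (c 3%nat = a * a * a + 2 * (1 - a * Cconj a) * a * x - (1 - a * Cconj a) * Cconj a * x * x
    + (1 - a * Cconj a) * (1 - x * Cconj x) * y)%C) by (unfold y; field; split; assumption).
  clearbody y.
  assert (T3 := HT (x * Cconj a - a + y * Cconj x)%C (- x - y * (Cconj x * a - Cconj a))%C (- y)%C 0).
  rewrite (Re_toeplitz_szego3 c a x y eq_refl H2 H3) in T3.
  destruct (Hlt _ _ (Rmult_lt_0_compat _ _ Ha' Hx') T3) as [Hy Hy']. assert (Ny := Hnz _ Hy').
  (* The value that [schur_coefficients] prescribes for c 4 at w = 0. *)
  set (k := (a * a * a * a + (1 - a * Cconj a) * x
      * (3 * a * a - 3 * a * Cconj a * x + Cconj a * Cconj a * x * x + x)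
    - (1 - a * Cconj a) * (1 - x * Cconj x) * (2 * (Cconj a * x - a) * y + Cconj x * y * y))%C).
  set (w := ((c 4%nat - k) / ((1 - a * Cconj a) * (1 - x * Cconj x) * (1 - y * Cconj y)))%C).
  assert (H4 : (c 4%nat = k + (1 - a * Cconj a) * (1 - x * Cconj x) * (1 - y * Cconj y) * w)%C)
    by (unfold w; field; repeat split; assumption).
  clearbody w.
  assert (HS : schur_coefficients c a x y w).
  { repeat split; [exact H2 | exact H3 | rewrite H4; unfold k; ring]. }
  exists a, x, y, w. split; [exact HS|].
  eassert (T4 := HT _ _ _ _). rewrite (Re_toeplitz_szego4 c a x y w HS) in T4.
  destruct (Hlt _ _ (Rmult_lt_0_compat _ _ (Rmult_lt_0_compat _ _ Ha' Hx') Hy') T4) as [Hw _].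
  auto.
Qed.

(** Scaling c by l amounts to a convex combination of the Toeplitz matrix with the identity. For l <
    1 nonnegativity thus becomes the strict lower bound 1 - l on vectors with v0 = 1, as
    [toeplitz_schur] requires. *)
Lemma Re_toeplitz_scal (c : nat -> C) (l : R) (v0 v1 v2 v3 v4 : C) :
  Re (toeplitz (fun n => l * c n)%C v0 v1 v2 v3 v4) =
  l * Re (toeplitz c v0 v1 v2 v3 v4) + (1 - l) * (Cmod v0 ^ 2 + Cmod v1 ^ 2 + Cmod v2 ^ 2 + Cmod v3 ^ 2 + Cmod v4 ^ 2).
Proof.
  rewrite <- re_scal_l, <- (re_RtoC (_ * (_ + _))), <- re_plus. f_equal.
  rewrite RtoC_mult, !RtoC_plus, RtoC_minus, !Cmod_sqr. unfold toeplitz. ring.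
Qed.

Lemma le_limit_at_1 (g : R -> R) (b : R) : continuity_pt g 1 ->
  (forall l, 0 < l < 1 -> g l <= b) -> g 1 <= b.
Proof.
  intros Hc H. destruct (Rle_dec (g 1) b) as [|Hn]; [assumption|exfalso].
  destruct (Hc (g 1 - b) ltac:(lra)) as (d & Hd & Hg).
  set (l := Rmax (1 / 2) (1 - d / 2)).
  assert (Hl : 0 < l < 1 /\ 1 - l < d).
  { unfold l. pose proof (Rmax_l (1 / 2) (1 - d / 2)). pose proof (Rmax_r (1 / 2) (1 - d / 2)).
    assert (Rmax (1 / 2) (1 - d / 2) < 1) by (apply Rmax_lub_lt; lra). lra. }
  specialize (Hg l). simpl in Hg. unfold R_dist, D_x, no_cond in Hg.
  assert (Hg' : Rabs (g l - g 1) < g 1 - b).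
  { apply Hg. split; [split; [exact I | lra]|]. rewrite Rabs_left; lra. }
  specialize (H l (proj1 Hl)). apply Rabs_def2 in Hg'. lra.
Qed.

(** The extremal u is conj z / |z|. Reducing a modulus to real parts lets the limit l -> 1 be taken
    in a real-valued function by [le_limit_at_1]. *)
Lemma Cmod_le_of_Re (z : C) (b : R) : 0 <= b -> (forall u, Cmod u <= 1 -> Re (u * z)%C <= b) -> Cmod z <= b.
Proof.
  intros Hb H. destruct (Req_dec (Cmod z) 0) as [E | E]; [lra|].
  assert (Hz := Cmod_ge_0 z).
  assert (Hk : (RtoC (/ Cmod z) * Cconj z * z)%C = Cmod z).
  { replace (RtoC (/ Cmod z) * Cconj z * z)%C with (RtoC (/ Cmod z) * (z * Cconj z))%C by ring.
    rewrite <- Cmod_sqr, <- RtoC_mult. f_equal. field. exact E. }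
  rewrite <- (re_RtoC (Cmod z)), <- Hk. apply H.
  rewrite Cmod_mult, Cmod_conj, Cmod_R, Rabs_pos_eq by (left; apply Rinv_0_lt_compat; lra).
  right. field. exact E.
Qed.

(** A singular form makes some factor 1 - |parameter|^2 vanish, and the quotients defining the later
    parameters break down. The bound is therefore proved for l c with l < 1 and carried to l = 1 by
    continuity. *)
Lemma inverse_hankel_le_of_toeplitz (c : nat -> C) :
  (forall v0 v1 v2 v3 v4 : C, 0 <= Re (toeplitz c v0 v1 v2 v3 v4)) ->
  Cmod (inverse_hankel c) <= 1 / 64.
Proof.
  intros HT.
  assert (Hl : forall l, 0 < l < 1 -> Cmod (inverse_hankel (fun n => l * c n)%C) <= 1 / 64).
  { intros l Hl.
    destruct (toeplitz_schur (fun n => l * c n)%C (1 - l)) as (a & x & y & w & HS & Ha & Hx & Hy & Hw); [lra| |].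
    - intros v1 v2 v3 v4. rewrite Re_toeplitz_scal. specialize (HT 1 v1 v2 v3 v4).
      rewrite Cmod_1. pose proof (pow2_ge_0 (Cmod v1)). pose proof (pow2_ge_0 (Cmod v2)).
      pose proof (pow2_ge_0 (Cmod v3)). pose proof (pow2_ge_0 (Cmod v4)). nra.
    - eapply inverse_hankel_le; eassumption. }
  apply Cmod_le_of_Re; [lra|]. intros u Hu.
  set (a2 := (c 1%nat / 2)%C). set (a3 := (2 * c 2%nat / 9)%C).
  set (a4 := (c 3%nat / 8)%C). set (a5 := (2 * c 4%nat / 25)%C).
  (* The real part of u times the determinant of l c, sorted by powers of l so that its continuity
     is evident. *)
  set (g := fun l : R => l ^ 2 * Re (u * (a3 * a5 - a4 * a4))%C
    + l ^ 3 * Re (u * (2 * a2 * a3 * a4 - 2 * a3 * a3 * a3 - a2 * a2 * a5))%C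
    + l ^ 4 * Re (u * (3 * a3 * a3 * a2 * a2))%C + l ^ 5 * Re (u * (-3 * a3 * a2 * a2 * a2 * a2))%C
    + l ^ 6 * Re (u * (a2 * a2 * a2 * a2 * a2 * a2))%C).
  assert (Hg : forall l, g l = Re (u * inverse_hankel (fun n => l * c n))%C).
  { intros l. unfold g. rewrite <- !re_scal_l, <- !re_plus. f_equal. rewrite !RtoC_pow.
    unfold inverse_hankel, a2, a3, a4, a5. Cfield. }
  replace (inverse_hankel c) with (inverse_hankel (fun n => 1 * c n)%C).
  2: { unfold inverse_hankel. rewrite !Cmult_1_l. reflexivity. }
  rewrite <- Hg. apply le_limit_at_1.
  - unfold g. reg.
  - intros l Hl'. rewrite Hg. eapply Rle_trans; [apply Rle_abs|]. eapply Rle_trans; [apply re_le_Cmod|].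
    rewrite Cmod_mult. specialize (Hl l Hl'). pose proof (Cmod_ge_0 u). pose proof (Cmod_ge_0 (inverse_hankel (fun n => l * c n)%C)). nra.
Qed.

(** * Power series over C *)

(** Only indices below n are summed, whereas [sum_n] includes n: the partial sum at n of a power
    series is then a polynomial of degree below n. *)
Fixpoint Csum (u : nat -> C) (n : nat) : C :=
  match n with O => 0%C | S k => (Csum u k + u k)%C end.

Lemma Csum_ext (u v : nat -> C) n : (forall k, (k < n)%nat -> u k = v k) -> Csum u n = Csum v n.
Proof.
  intros H. induction n as [|n IH]; [reflexivity|]. simpl. rewrite IH, H; auto.
Qed.

Lemma Csum_plus (u v : nat -> C) n : Csum (fun k => u k + v k)%C n = (Csum u n + Csum v n)%C.
Proof. induction n as [|n IH]; simpl; [ring|]. rewrite IH. ring. Qed.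

Lemma Csum_scal (c : C) (u : nat -> C) n : Csum (fun k => c * u k)%C n = (c * Csum u n)%C.
Proof. induction n as [|n IH]; simpl; [ring|]. rewrite IH. ring. Qed.

Lemma Csum_zero n : Csum (fun _ => 0%C) n = 0%C.
Proof. induction n as [|n IH]; simpl; [ring|]. rewrite IH. ring. Qed.

Lemma Csum_switch (u : nat -> nat -> C) n m :
  Csum (fun i => Csum (u i) m) n = Csum (fun j => Csum (fun i => u i j) n) m.
Proof.
  induction n as [|n IH]; simpl; [now rewrite Csum_zero|]. rewrite IH, <- Csum_plus. reflexivity.
Qed.

Lemma Csum_single (k n : nat) (v : C) : (k < n)%nat ->
  Csum (fun i => if Nat.eq_dec i k then v else 0%C) n = v.
Proof.
  intros H. induction n as [|n IH]; [lia|]. simpl. destruct (Nat.eq_dec n k) as [->|Hn].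
  - rewrite (Csum_ext _ (fun _ => 0%C)), Csum_zero; [ring|]. intros i Hi. destruct (Nat.eq_dec i k); [lia|reflexivity].
  - rewrite IH by lia. ring.
Qed.

Lemma Csum_shift (u : nat -> C) n : Csum u (S n) = (u O + Csum (fun k => u (S k)) n)%C.
Proof. induction n as [|n IH]; [simpl; ring|]. simpl in *. rewrite IH. ring. Qed.

Lemma Cmod_Csum_le (u : nat -> C) (b : R) n : (forall k, (k < n)%nat -> Cmod (u k) <= b) ->
  Cmod (Csum u n) <= INR n * b.
Proof.
  intros H. induction n as [|n IH]; [simpl; rewrite Cmod_0; lra|]. rewrite S_INR. simpl Csum.
  replace ((INR n + 1) * b) with (INR n * b + b) by ring. apply Cmod_triangle_le; auto.
Qed.

Lemma Csum_tail_geom (u : nat -> C) (M t : R) : 0 <= t < 1 -> (forall k, Cmod (u k) <= M * t ^ k) ->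
  forall m p, Cmod (Csum u (m + p) - Csum u m) <= M * t ^ m / (1 - t).
Proof.
  intros Ht H m p.
  assert (HM : 0 <= M) by (specialize (H O); pose proof (Cmod_ge_0 (u O)); simpl in H; lra).
  (* The factor 1 - t^p makes this the exact geometric sum, which carries the induction; it is
     discarded afterwards. *)
  assert (Hp : Cmod (Csum u (m + p) - Csum u m) <= M * t ^ m * (1 - t ^ p) / (1 - t)).
  { induction p as [|p IH].
    - rewrite Nat.add_0_r. replace (Csum u m - Csum u m)%C with (RtoC 0) by ring. rewrite Cmod_0. simpl.
      right. field. lra.
    - rewrite Nat.add_succ_r. simpl Csum.
      replace (Csum u (m + p) + u (m + p)%nat - Csum u m)%C
        with ((Csum u (m + p) - Csum u m) + u (m + p)%nat)%C by ring.
      replace (M * t ^ m * (1 - t ^ S p) / (1 - t))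
        with (M * t ^ m * (1 - t ^ p) / (1 - t) + M * t ^ (m + p)) by (rewrite pow_add; simpl; field; lra).
      apply Cmod_triangle_le; auto. }
  eapply Rle_trans; [exact Hp|]. unfold Rdiv. apply Rmult_le_compat_r; [left; apply Rinv_0_lt_compat; lra|].
  assert (0 <= t ^ p) by (apply pow_le; lra). assert (0 <= M * t ^ m) by (apply Rmult_le_pos; [|apply pow_le]; lra). nra.
Qed.

Definition tends (u : nat -> C) (l : C) : Prop :=
  forall e, 0 < e -> exists N, forall n, (N <= n)%nat -> Cmod (u n - l) < e.

Lemma Cmod_minus_sym (x y : C) : Cmod (x - y) = Cmod (y - x).
Proof. rewrite <- Cmod_opp. f_equal. ring. Qed.

Lemma Cmod_triang3 (x y z : C) : Cmod (x - z) <= Cmod (x - y) + Cmod (y - z).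
Proof. replace (x - z)%C with ((x - y) + (y - z))%C by ring. apply Cmod_triangle. Qed.

Lemma Cmod_small_eq (x y : C) : (forall e, 0 < e -> Cmod (x - y) <= e) -> x = y.
Proof.
  intros H. apply Ceq_minus, Cmod_eq_0. apply Rle_antisym; [|apply Cmod_ge_0].
  apply Rle_plus_epsilon. intros e He. rewrite Rplus_0_l. auto.
Qed.

Lemma tends_unique u l1 l2 : tends u l1 -> tends u l2 -> l1 = l2.
Proof.
  intros H1 H2. apply Cmod_small_eq. intros e He.
  destruct (H1 (e / 2)) as [N1 P1]; [lra|]. destruct (H2 (e / 2)) as [N2 P2]; [lra|].
  specialize (P1 (N1 + N2)%nat ltac:(lia)). specialize (P2 (N1 + N2)%nat ltac:(lia)).
  pose proof (Cmod_triang3 l1 (u (N1 + N2)%nat) l2). rewrite Cmod_minus_sym in P1. lra.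
Qed.

Lemma tends_ext_from (n0 : nat) u v l : (forall n, (n0 <= n)%nat -> u n = v n) -> tends u l -> tends v l.
Proof.
  intros E H e He. destruct (H e He) as [N P]. exists (n0 + N)%nat. intros n Hn. rewrite <- E by lia. apply P. lia.
Qed.

Lemma tends_plus u v a b : tends u a -> tends v b -> tends (fun n => u n + v n)%C (a + b)%C.
Proof.
  intros H1 H2 e He. destruct (H1 (e / 2)) as [N1 P1]; [lra|]. destruct (H2 (e / 2)) as [N2 P2]; [lra|].
  exists (N1 + N2)%nat. intros n Hn. specialize (P1 n ltac:(lia)). specialize (P2 n ltac:(lia)).
  replace (u n + v n - (a + b))%C with ((u n - a) + (v n - b))%C by ring.
  eapply Rle_lt_trans; [apply Cmod_triangle|]. lra.
Qed.

Lemma tends_scal c u a : tends u a -> tends (fun n => c * u n)%C (c * a)%C.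
Proof.
  intros H e He. pose proof (Cmod_ge_0 c). destruct (H (e / (Cmod c + 1))) as [N P]; [apply Rdiv_lt_0_compat; lra|].
  exists N. intros n Hn. replace (c * u n - c * a)%C with (c * (u n - a))%C by ring. rewrite Cmod_mult.
  specialize (P n Hn). pose proof (Cmod_ge_0 (u n - a)).
  apply Rle_lt_trans with ((Cmod c + 1) * Cmod (u n - a)); [nra|].
  apply Rmult_lt_compat_l with (r := Cmod c + 1) in P; [|lra].
  replace ((Cmod c + 1) * (e / (Cmod c + 1))) with e in P by (field; lra). exact P.
Qed.

Lemma tends_const c : tends (fun _ => c) c.
Proof.
  intros e He. exists O. intros n _. replace (c - c)%C with (RtoC 0) by ring. now rewrite Cmod_0.
Qed.

Lemma tends_succ u a : tends u a -> tends (fun n => u (S n)) a.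
Proof. intros H e He. destruct (H e He) as [N P]. exists N. intros n Hn. apply P. lia. Qed.

Lemma tends_pred u a : tends (fun n => u (S n)) a -> tends u a.
Proof.
  intros H e He. destruct (H e He) as [N P]. exists (S N). intros [|n] Hn; [lia|]. apply P. lia.
Qed.

Lemma tends_bounded u a : tends u a -> exists M, forall n, Cmod (u n) <= M.
Proof.
  intros H. destruct (H 1 Rlt_0_1) as [N P].
  assert (HN : forall m, exists M, forall n, (n < m)%nat -> Cmod (u n) <= M).
  { induction m as [|m [M HM]]; [exists 0; intros; lia|]. exists (Rmax M (Cmod (u m))). intros n Hn.
    destruct (Nat.eq_dec n m) as [->|]; [apply Rmax_r|]. eapply Rle_trans; [apply HM; lia | apply Rmax_l]. }
  destruct (HN N) as [M HM]. exists (Rmax M (Cmod a + 1)). intros n.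
  destruct (Nat.lt_ge_cases n N) as [Hn|Hn].
  - eapply Rle_trans; [apply HM, Hn | apply Rmax_l].
  - eapply Rle_trans; [|apply Rmax_r]. specialize (P n Hn).
    replace (u n) with (a + (u n - a))%C by ring. eapply Rle_trans; [apply Cmod_triangle|]. lra.
Qed.

Lemma tends_Cmod_le u a x b : tends u a -> (exists N, forall n, (N <= n)%nat -> Cmod (u n - x) <= b) -> Cmod (a - x) <= b.
Proof.
  intros H [N HN]. apply Rle_plus_epsilon. intros e He. destruct (H e He) as [N' P].
  specialize (P (N + N')%nat ltac:(lia)). specialize (HN (N + N')%nat ltac:(lia)).
  pose proof (Cmod_triang3 a (u (N + N')%nat) x). rewrite Cmod_minus_sym in P. lra.
Qed.

Lemma filterlim_tends (u : nat -> C) (l : C) :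
  filterlim u eventually (@locally C_NormedModule l) <-> tends u l.
Proof.
  rewrite (@filterlim_locally_ball_norm C_AbsRing nat C_NormedModule eventually _). split.
  - intros H e He. exact (H (mkposreal e He)).
  - intros H e. exact (H e (cond_pos e)).
Qed.

Lemma tends_Cauchy (u : nat -> C) :
  (forall e, 0 < e -> exists N, forall n m, (N <= n)%nat -> (N <= m)%nat -> Cmod (u n - u m) <= e) ->
  exists l, tends u l.
Proof.
  intros H.
  assert (HR : forall p : C -> R, (forall x y, Rabs (p x - p y) <= Cmod (x - y)) ->
    exists l, Un_cv (fun n => p (u n)) l).
  { intros p Hp. destruct (Rcomplete.R_complete (fun n => p (u n))) as [l Hl]; [|exists l; exact Hl].
    intros e He. destruct (H (e / 2)) as [N HN]; [lra|]. exists N. intros n m Hn Hm.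
    unfold Rdist. eapply Rle_lt_trans; [apply Hp|]. eapply Rle_lt_trans; [apply HN; assumption|]. lra. }
  destruct (HR Re) as [l1 H1].
  { intros x y. apply (re_le_Cmod (x - y)). }
  destruct (HR Im) as [l2 H2].
  { intros x y. eapply Rle_trans; [apply (Rmax_r (Rabs (fst (x - y)%C))) | apply Rmax_Cmod]. }
  exists (l1, l2). intros e He. destruct (H1 (e / 2)) as [N1 P1]; [lra|]. destruct (H2 (e / 2)) as [N2 P2]; [lra|].
  exists (N1 + N2)%nat. intros n Hn. specialize (P1 n ltac:(lia)). specialize (P2 n ltac:(lia)).
  unfold Rdist in *.
  replace (u n - (l1, l2))%C with (RtoC (Re (u n) - l1) + RtoC (Im (u n) - l2) * Ci)%C.
  2: { destruct (u n) as [x y]. unfold RtoC, Ci, Cminus, Cplus, Cmult, Copp; simpl. f_equal; ring. }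
  eapply Rle_lt_trans; [apply Cmod_triangle|]. rewrite Cmod_mult, Cmod_Ci, !Cmod_R. lra.
Qed.

Definition ps (a : nat -> C) (z l : C) : Prop := tends (Csum (fun k => a k * z ^ k)%C) l.

Lemma is_pseries_ps (a : nat -> C) (z l : C) : @is_pseries C_AbsRing C_NormedModule a z l <-> ps a z l.
Proof.
  unfold is_pseries, is_series. rewrite filterlim_tends.
  assert (E : forall n, sum_n (fun k => scal (pow_n (K := C_AbsRing) z k) (a k : C_NormedModule)) n
    = Csum (fun k => a k * z ^ k)%C (S n)).
  { assert (Hp : forall k, pow_n (K := C_AbsRing) z k = (z ^ k)%C).
    { induction k as [|k IH]; [reflexivity|]. simpl. rewrite IH. reflexivity. }
    induction n as [|n IH].
    - rewrite sum_O, Hp. change (scal (z ^ 0)%C (a O)) with (z ^ 0 * a O)%C. simpl. ring.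
    - rewrite sum_Sn, IH, Hp.
      change (scal (z ^ S n)%C (a (S n))) with (z ^ S n * a (S n))%C.
      change (Csum (fun k => a k * z ^ k)%C (S (S n)))
        with (Csum (fun k => a k * z ^ k) (S n) + a (S n) * z ^ S n)%C.
      rewrite Cmult_comm with (x := a (S n)). reflexivity. }
  split; intros H.
  - apply tends_pred. refine (tends_ext_from 0 _ _ _ _ H). intros n _. apply E.
  - apply (tends_ext_from 0 (fun n => Csum (fun k => a k * z ^ k)%C (S n))); [intros n _; symmetry; apply E|].
    apply tends_succ, H.
Qed.

Definition ps_on (a : nat -> C) (r : R) (f : C -> C) : Prop := forall z, Cmod z < r -> ps a z (f z).

Lemma ps_coefficient_bound a z l : ps a z l -> exists M, forall n, Cmod (a n) * Cmod z ^ n <= M.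
Proof.
  intros H. destruct (tends_bounded _ _ H) as [M HM]. exists (M + M). intros n.
  rewrite <- Cmod_pow, <- Cmod_mult.
  replace (a n * z ^ n)%C with (Csum (fun k => a k * z ^ k) (S n) + - Csum (fun k => a k * z ^ k) n)%C by (simpl; ring).
  apply Cmod_triangle_le; rewrite ?Cmod_opp; apply HM.
Qed.

(** The terms of the convergent series at the real point p are bounded. Geometric decay of the terms
    on smaller discs follows, and with it the later convergence estimates. *)
Lemma ps_on_coefficient_bound a r f p : ps_on a r f -> 0 <= p < r -> exists M, forall n, Cmod (a n) * p ^ n <= M.
Proof.
  intros H Hp. assert (E : Cmod p = p) by (rewrite Cmod_R; apply Rabs_pos_eq; lra).
  destruct (ps_coefficient_bound a p (f p)) as [M HM]; [apply H; lra|]. exists M. rewrite E in HM. exact HM.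
Qed.

Lemma ps_term_bound a M p t z : 0 < p -> (forall n, Cmod (a n) * p ^ n <= M) -> Cmod z <= t * p ->
  forall n, Cmod (a n * z ^ n) <= M * t ^ n.
Proof.
  intros Hp HM Hz n. rewrite Cmod_mult, Cmod_pow.
  assert (0 <= Cmod z) by apply Cmod_ge_0. assert (0 <= t) by (destruct (Rle_dec 0 t); nra).
  apply Rle_trans with (Cmod (a n) * (t * p) ^ n).
  - apply Rmult_le_compat_l; [apply Cmod_ge_0 | apply pow_incr; lra].
  - rewrite Rpow_mult_distr. specialize (HM n). assert (0 <= t ^ n) by (apply pow_le; lra). nra.
Qed.

Lemma ps_tail a M p t z l : 0 < p -> 0 <= t < 1 -> (forall n, Cmod (a n) * p ^ n <= M) -> Cmod z <= t * p ->
  ps a z l -> forall N, Cmod (l - Csum (fun k => a k * z ^ k)%C N) <= M * t ^ N / (1 - t).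
Proof.
  intros Hp Ht HM Hz H N. eapply tends_Cmod_le; [exact H|]. exists N. intros n Hn.
  replace n with (N + (n - N))%nat by lia. apply Csum_tail_geom; [exact Ht|]. eapply ps_term_bound; eassumption.
Qed.

Lemma pow_small (M t e : R) : 0 <= M -> 0 <= t < 1 -> 0 < e -> exists N, forall n, (N <= n)%nat -> M * t ^ n <= e.
Proof.
  intros HM Ht He. destruct (pow_lt_1_zero t) with (y := e / (M + 1)) as [N HN].
  - rewrite Rabs_pos_eq; lra.
  - apply Rdiv_lt_0_compat; lra.
  - exists N. intros n Hn. specialize (HN n Hn). assert (0 <= t ^ n) by (apply pow_le; lra).
    rewrite Rabs_pos_eq in HN by assumption. apply Rmult_lt_compat_l with (r := M + 1) in HN; [|lra].
    replace ((M + 1) * (e / (M + 1))) with e in HN by (field; lra). nra.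
Qed.

Lemma ps_converges a M p z : 0 < p -> (forall n, Cmod (a n) * p ^ n <= M) -> Cmod z < p -> exists l, ps a z l.
Proof.
  intros Hp HM Hz. set (t := Cmod z / p).
  assert (Htp : t * p = Cmod z) by (unfold t; field; lra). assert (Ht : 0 <= t < 1) by (pose proof (Cmod_ge_0 z); split; nra).
  assert (HM0 : 0 <= M) by (specialize (HM O); pose proof (Cmod_ge_0 (a O)); simpl in HM; lra).
  assert (HT := ps_term_bound a M p t z Hp HM ltac:(lra)).
  apply tends_Cauchy. intros e He.
  destruct (pow_small (2 * M / (1 - t)) t e) as [N HN]; [apply Rmult_le_pos; [lra | left; apply Rinv_0_lt_compat; lra] | lra | lra |].
  specialize (HN N (le_n N)). exists N. intros n m Hn Hm.
  assert (A := Csum_tail_geom _ M t Ht HT N (n - N)). assert (B := Csum_tail_geom _ M t Ht HT N (m - N)).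
  replace (N + (n - N))%nat with n in A by lia. replace (N + (m - N))%nat with m in B by lia.
  set (u := Csum (fun k => (a k * z ^ k)%C)) in *.
  pose proof (Cmod_triang3 (u n) (u N) (u m)). rewrite (Cmod_minus_sym (u N)) in H.
  replace (2 * M / (1 - t) * t ^ N) with (M * t ^ N / (1 - t) + M * t ^ N / (1 - t)) in HN by (field; lra). lra.
Qed.

Lemma ps_on_uniform a r f p e : ps_on a r f -> 0 < p < r -> 0 < e ->
  exists N0, forall N z, (N0 <= N)%nat -> Cmod z <= p -> Cmod (f z - Csum (fun k => a k * z ^ k)%C N) <= e.
Proof.
  (* A coefficient bound at a radius q strictly between p and r yields the ratio p / q < 1 on all of
     |z| <= p. *)
  intros H Hp He. set (q := (p + r) / 2). assert (Hq : p < q < r) by (unfold q; lra).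
  destruct (ps_on_coefficient_bound a r f q H) as [M HM]; [lra|]. set (t := p / q).
  assert (Htq : t * q = p) by (unfold t; field; lra). assert (Ht : 0 <= t < 1) by (split; nra).
  assert (HM0 : 0 <= M) by (specialize (HM O); pose proof (Cmod_ge_0 (a O)); simpl in HM; lra).
  destruct (pow_small (M / (1 - t)) t e) as [N0 HN]; [apply Rmult_le_pos; [lra | left; apply Rinv_0_lt_compat; lra] | lra | lra |].
  exists N0. intros N z HNN Hz. eapply Rle_trans.
  - apply (ps_tail a M q t); try lra; [exact HM | apply H; lra].
  - specialize (HN N HNN). unfold Rdiv in *. lra.
Qed.

Lemma ps_plus a b z l m : ps a z l -> ps b z m -> ps (fun n => a n + b n)%C z (l + m)%C.
Proof.
  intros H1 H2. refine (tends_ext_from 0 _ _ _ _ (tends_plus _ _ _ _ H1 H2)). intros n _. rewrite <- Csum_plus.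
  apply Csum_ext. intros; ring.
Qed.

Lemma ps_scal c a z l : ps a z l -> ps (fun n => c * a n)%C z (c * l)%C.
Proof.
  intros H. refine (tends_ext_from 0 _ _ _ _ (tends_scal c _ _ H)). intros n _. rewrite <- Csum_scal.
  apply Csum_ext. intros; ring.
Qed.

Definition shift (a : nat -> C) (n : nat) : C := match n with O => 0%C | S k => a k end.

Lemma ps_shift a z l : ps a z l -> ps (shift a) z (z * l)%C.
Proof.
  intros H. apply tends_pred. refine (tends_ext_from 0 _ _ _ _ (tends_scal z _ _ H)). intros n _.
  rewrite Csum_shift, <- Csum_scal. simpl. rewrite Cmult_0_l, Cplus_0_l. apply Csum_ext. intros; simpl; ring.
Qed.

Lemma ps_decr a (z l : C) : z <> 0 -> ps a z l -> ps (fun n => a (S n)) z ((l - a O) / z)%C.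
Proof.
  intros Hz H. assert (K := tends_scal (/ z) _ _ (tends_plus _ _ _ _ (tends_succ _ _ H) (tends_const (- a O)%C))).
  replace ((l - a O) / z)%C with (/ z * (l + - a O))%C by (unfold Cdiv; ring).
  refine (tends_ext_from 0 _ _ _ _ K). intros n _. cbv beta. rewrite Csum_shift.
  replace (a O * z ^ 0 + Csum (fun k => a (S k) * z ^ S k) n + - a O)%C with (Csum (fun k => a (S k) * z ^ S k) n)%C by (simpl; ring).
  rewrite <- Csum_scal. apply Csum_ext. intros k _. simpl. field. exact Hz.
Qed.

Lemma ps_ext a b z l : (forall n, a n = b n) -> ps a z l -> ps b z l.
Proof.
  intros E H. refine (tends_ext_from 0 _ _ _ _ H). intros n _. apply Csum_ext. intros k _. now rewrite E.
Qed.

Lemma ps_at_0 a : ps a 0 (a O).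
Proof.
  apply (tends_ext_from 1 (fun _ => a O)); [|apply tends_const]. intros [|n] Hn; [lia|].
  rewrite Csum_shift, (Csum_ext _ (fun _ => 0%C)), Csum_zero; [simpl; ring|]. intros; simpl; ring.
Qed.

(** * Roots of unity, Fourier coefficients and Cauchy's estimate *)

Definition circle (t : R) : C := (cos t, sin t).

Lemma circle_plus s t : circle (s + t) = (circle s * circle t)%C.
Proof. unfold circle, Cmult; simpl. rewrite cos_plus, sin_plus. f_equal. ring. Qed.

Lemma circle_pow t n : (circle t ^ n)%C = circle (INR n * t).
Proof.
  induction n as [|n IH]; [unfold circle; simpl; rewrite Rmult_0_l, cos_0, sin_0; reflexivity|].
  rewrite S_INR, Rmult_plus_distr_r, circle_plus, <- IH, Rmult_1_l. simpl. ring.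
Qed.

Lemma circle_conj t : (circle t * Cconj (circle t))%C = 1.
Proof.
  unfold circle, Cconj, Cmult; simpl. pose proof (sin2_cos2 t). unfold Rsqr in *. unfold RtoC. f_equal; nra.
Qed.

Lemma Cmod_circle t : Cmod (circle t) = 1.
Proof.
  pose proof (Cmod_sqr (circle t)) as H. rewrite circle_conj in H. apply RtoC_inj in H. pose proof (Cmod_ge_0 (circle t)). nra.
Qed.

Lemma circle_2PI (n : nat) : circle (INR n * (2 * PI)) = 1.
Proof.
  rewrite <- circle_pow. unfold circle at 1. rewrite cos_2PI, sin_2PI. apply Cpow_1_l.
Qed.

Lemma circle_neq_1 t : 0 < t < 2 * PI -> circle t <> 1.
Proof.
  intros Ht E. apply (f_equal Re) in E. simpl in E. replace t with (2 * (t / 2)) in E by field.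
  rewrite cos_2a_sin in E. assert (0 < sin (t / 2)) by (apply sin_gt_0; lra). nra.
Qed.

Definition node (N k : nat) : C := circle (INR k * (2 * PI / INR N)).

(** A geometric sum with ratio q satisfying q^N = 1; 0 < d < N guarantees q <> 1. *)
Lemma node_power_sum N d : (0 < d < N)%nat -> Csum (fun k => node N k ^ d)%C N = 0.
Proof.
  intros Hd. assert (HN : 0 < INR N) by (apply lt_0_INR; lia). assert (Hd0 : 0 < INR d) by (apply lt_0_INR; lia).
  assert (HdN : INR d < INR N) by (apply lt_INR; lia). pose proof PI_RGT_0.
  set (q := circle (INR d * (2 * PI / INR N))).
  assert (Hq1 : q <> 1).
  { apply circle_neq_1. replace (INR d * (2 * PI / INR N)) with (INR d / INR N * (2 * PI)) by (field; lra).
    assert (0 < INR d / INR N) by (apply Rdiv_lt_0_compat; lra).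
    assert (INR d / INR N < 1) by (apply Rmult_lt_reg_r with (INR N); [lra|]; unfold Rdiv; rewrite Rmult_assoc, Rinv_l; lra).
    split; nra. }
  assert (HqN : (q ^ N)%C = 1).
  { unfold q. rewrite circle_pow. replace (INR N * (INR d * (2 * PI / INR N))) with (INR d * (2 * PI)) by (field; lra).
    apply circle_2PI. }
  assert (G : forall n, ((q - 1) * Csum (fun k => q ^ k) n)%C = (q ^ n - 1)%C).
  { induction n as [|n IH]; simpl; [ring|]. rewrite Cmult_plus_distr_l, IH. ring. }
  rewrite (Csum_ext _ (fun k => q ^ k)%C).
  - specialize (G N). rewrite HqN in G. replace (1 - 1)%C with (RtoC 0) in G by ring.
    assert (q - 1 <> 0)%C by (intros E; apply Hq1; replace q with (q - 1 + 1)%C by ring; rewrite E; ring).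
    replace (Csum (fun k => q ^ k) N)%C with (/ (q - 1) * ((q - 1) * Csum (fun k => q ^ k) N))%C by (field; assumption).
    rewrite G. ring.
  - intros k _. unfold node, q. rewrite !circle_pow. f_equal. ring.
Qed.

Lemma Csum_conj u n : Cconj (Csum u n) = Csum (fun k => Cconj (u k)) n.
Proof. induction n as [|n IH]; simpl; [apply Cconj_RtoC|]. rewrite Cplus_conj, IH. reflexivity. Qed.

(** With both exponents below N, the difference m - n is never a nonzero multiple of N, so there is
    no aliasing. *)
Lemma node_orthogonality N m n : (m < N)%nat -> (n < N)%nat ->
  Csum (fun k => node N k ^ m * Cconj (node N k) ^ n)%C N = if Nat.eq_dec m n then RtoC (INR N) else 0%C.
Proof.
  intros Hm Hn.
  assert (E : forall k p, (node N k ^ p * Cconj (node N k) ^ p)%C = 1).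
  { intros k p. unfold node. rewrite <- Cpow_mult_l, circle_conj. apply Cpow_1_l. }
  destruct (Nat.eq_dec m n) as [<-|Hne].
  - rewrite (Csum_ext _ (fun _ => 1%C)) by (intros; apply E). clear.
    induction N as [|N IH]; [reflexivity|]. rewrite S_INR, RtoC_plus, <- IH. reflexivity.
  - destruct (Nat.lt_ge_cases m n) as [H|H].
    + rewrite (Csum_ext _ (fun k => Cconj (node N k ^ (n - m))%C)).
      * rewrite <- Csum_conj, node_power_sum by lia. apply Cconj_RtoC.
      * intros k _. replace n with (m + (n - m))%nat at 1 by lia. rewrite Cpow_add_r, Cmult_assoc, E, Cpow_conj. ring.
    + rewrite (Csum_ext _ (fun k => node N k ^ (m - n))%C); [apply node_power_sum; lia|].
      intros k _. replace m with ((m - n) + n)%nat at 1 by lia. rewrite Cpow_add_r, <- Cmult_assoc, E. ring.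
Qed.

(** Plays the role of the integral mean over the unit circle. *)
Definition average (N : nat) (F : C -> C) : C := (/ INR N * Csum (fun k => F (node N k)) N)%C.

Lemma average_le N F b : (0 < N)%nat -> (forall u, Cmod u = 1 -> Cmod (F u) <= b) -> Cmod (average N F) <= b.
Proof.
  intros HN H. assert (0 < INR N) by (apply lt_0_INR; lia). unfold average.
  rewrite Cmod_mult, <- RtoC_inv, Cmod_R, Rabs_pos_eq by (try lra; left; apply Rinv_0_lt_compat; lra).
  apply Rmult_le_reg_l with (INR N); [lra|]. rewrite <- Rmult_assoc, Rinv_r, Rmult_1_l by lra.
  apply Cmod_Csum_le. intros k _. apply H, Cmod_circle.
Qed.

Lemma average_minus N F G : (average N F - average N G)%C = average N (fun u => F u - G u)%C.
Proof.
  unfold average. rewrite (Csum_ext (fun k => F (node N k) - G (node N k))%C (fun k => F (node N k) + (-(1)) * G (node N k))%C) by (intros; ring).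
  rewrite Csum_plus, Csum_scal. ring.
Qed.

(* Replacing f by a Taylor polynomial of degree below N makes the average over
   the N-th roots of unity an exact Fourier coefficient. *)
Lemma average_coefficient a r f p n : ps_on a r f -> 0 < p < r ->
  tends (fun N => average N (fun u => f (p * u) * Cconj u ^ n)%C) (a n * p ^ n)%C.
Proof.
  intros H Hp e He. destruct (ps_on_uniform a r f p (e / 2) H Hp) as [N0 HN0]; [lra|].
  (* K >= N0 gives the approximation, K > n keeps the term of index n in the Taylor polynomial, and
     N >= K keeps all exponents below N. *)
  set (K := (N0 + S n)%nat). exists K. intros N HN. assert (0 < INR N) by (apply lt_0_INR; lia).
  assert (E : average N (fun u => Csum (fun m => a m * (p * u) ^ m) K * Cconj u ^ n)%C = (a n * p ^ n)%C).
  { unfold average.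
    rewrite (Csum_ext _ (fun k => Csum (fun m => (a m * p ^ m) * (node N k ^ m * Cconj (node N k) ^ n)) K)%C).
    2: { intros k _. rewrite Cmult_comm, <- Csum_scal. apply Csum_ext. intros m _. rewrite Cpow_mult_l. ring. }
    rewrite Csum_switch.
    rewrite (Csum_ext _ (fun m => if Nat.eq_dec m n then INR N * (a n * p ^ n) else 0)%C).
    2: { intros m Hm. rewrite Csum_scal, node_orthogonality by lia. destruct (Nat.eq_dec m n) as [->|]; ring. }
    rewrite Csum_single by lia. field. apply RtoC_neq. lra. }
  rewrite <- E, average_minus. apply Rle_lt_trans with (e / 2); [|lra].
  apply average_le; [lia|]. intros u Hu.
  replace (f (p * u) * Cconj u ^ n - Csum (fun m => a m * (p * u) ^ m) K * Cconj u ^ n)%C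
    with ((f (p * u) - Csum (fun m => a m * (p * u) ^ m) K) * Cconj u ^ n)%C by ring.
  rewrite Cmod_mult, Cmod_pow, Cmod_conj, Hu, pow1, Rmult_1_r. apply HN0; [lia|].
  rewrite Cmod_mult, Hu, Cmod_R, Rabs_pos_eq; lra.
Qed.

(** The coefficient is a limit of averages over |z| = p, each of modulus at most M. *)
Lemma cauchy_estimate a r f p M n : ps_on a r f -> 0 < p < r ->
  (forall z, Cmod z = p -> Cmod (f z) <= M) -> Cmod (a n) * p ^ n <= M.
Proof.
  intros H Hp HM.
  replace (Cmod (a n) * p ^ n) with (Cmod (a n * p ^ n - 0)).
  2: { rewrite <- RtoC_pow. replace (a n * (p ^ n)%R - 0)%C with (a n * (p ^ n)%R)%C by ring.
       rewrite Cmod_mult, Cmod_R, Rabs_pos_eq; [reflexivity | apply pow_le; lra]. }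
  eapply tends_Cmod_le; [eapply average_coefficient; eassumption|]. exists 1%nat. intros N HN.
  unfold Cminus. rewrite Copp_0, Cplus_0_r.
  apply average_le; [lia|]. intros u Hu. rewrite Cmod_mult, Cmod_pow, Cmod_conj, Hu, pow1, Rmult_1_r. apply HM.
  rewrite Cmod_mult, Hu, Cmod_R, Rabs_pos_eq; lra.
Qed.

(** * The Caratheodory-Toeplitz inequality and Weierstrass' theorem *)

Lemma average_plus N F G : average N (fun u => F u + G u)%C = (average N F + average N G)%C.
Proof. unfold average. rewrite Csum_plus. ring. Qed.

Lemma average_scal N c F : average N (fun u => c * F u)%C = (c * average N F)%C.
Proof. unfold average. rewrite Csum_scal. ring. Qed.

Lemma average_ext N F G : (forall u, F u = G u) -> average N F = average N G.
Proof. intros H. unfold average. f_equal. apply Csum_ext. intros; apply H. Qed.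

Lemma Re_Csum_ge_0 u n : (forall k, 0 <= Re (u k)) -> 0 <= Re (Csum u n).
Proof. intros H. induction n as [|n IH]; simpl; [lra|]. specialize (H n). unfold Re in *. lra. Qed.

Lemma tends_Re_ge_0 u l : tends u l -> (forall n, 0 <= Re (u (S n))) -> 0 <= Re l.
Proof.
  intros H P. apply Rle_plus_epsilon. intros e He. destruct (H e He) as [N HN]. specialize (HN (S N) ltac:(lia)).
  specialize (P N). assert (Q := re_le_Cmod (u (S N) - l)). 
  assert (Q' := Rle_abs (Re (u (S N) - l))). unfold Re, Cminus, Cplus, Copp in *. simpl in *. lra.
Qed.

Lemma toeplitz_ge_0 (b c : nat -> C) (p : C -> C) : ps_on b 1 p -> b O = 1 -> (forall n, b (S n) = 2 * c (S n))%C ->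
  (forall z, Cmod z < 1 -> 0 < Re (p z)) -> forall v0 v1 v2 v3 v4, 0 <= Re (toeplitz c v0 v1 v2 v3 v4).
Proof.
  intros H Hb0 Hb Hp v0 v1 v2 v3 v4.
  (* The coefficients of p q; multiplication by z is [shift]. *)
  set (d := fun n => (v0 * b n + (v1 * shift b n + (v2 * shift (shift b) n
    + (v3 * shift (shift (shift b)) n + v4 * shift (shift (shift (shift b))) n))))%C).
  set (q := fun z : C => (v0 + v1 * z + v2 * z ^ 2 + v3 * z ^ 3 + v4 * z ^ 4)%C).
  assert (Hd : ps_on d 1 (fun z => p z * q z)%C).
  { intros z Hz. specialize (H z Hz).
    replace (p z * q z)%C with (v0 * p z + (v1 * (z * p z) + (v2 * (z * (z * p z))
      + (v3 * (z * (z * (z * p z))) + v4 * (z * (z * (z * (z * p z))))))))%C by (unfold q; ring).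
    unfold d. repeat apply ps_plus; apply ps_scal; repeat apply ps_shift; exact H. }
  (* The limit of the averages of p |q|^2 over |z| = l: the term conj(v_j) l^j conj(u)^j of conj q
     picks out d_j l^j. At l = 1 it is the Toeplitz form, but p is controlled only inside the disc,
     so l -> 1 comes last. *)
  set (T := fun l : R => (Cconj v0 * d 0%nat + l ^ 2 * (Cconj v1 * d 1%nat) + l ^ 4 * (Cconj v2 * d 2%nat)
    + l ^ 6 * (Cconj v3 * d 3%nat) + l ^ 8 * (Cconj v4 * d 4%nat))%C).
  assert (HT : forall l : R, 0 < l < 1 -> 0 <= Re (T l)).
  { intros l Hl.
    assert (Hlim : tends (fun N => average N (fun u => p (l * u) * q (l * u) * Cconj (q (l * u)))%C) (T l)).
    { set (A := fun n => average_coefficient d 1 _ l n Hd Hl).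
      assert (K := tends_plus _ _ _ _ (tends_plus _ _ _ _ (tends_plus _ _ _ _ (tends_plus _ _ _ _
        (tends_scal (Cconj v0) _ _ (A 0%nat)) (tends_scal (Cconj v1 * l) _ _ (A 1%nat)))
        (tends_scal (Cconj v2 * l ^ 2) _ _ (A 2%nat))) (tends_scal (Cconj v3 * l ^ 3) _ _ (A 3%nat)))
        (tends_scal (Cconj v4 * l ^ 4) _ _ (A 4%nat))).
      replace (T l) with (Cconj v0 * (d 0%nat * l ^ 0) + Cconj v1 * l * (d 1%nat * l ^ 1)
         + Cconj v2 * l ^ 2 * (d 2%nat * l ^ 2) + Cconj v3 * l ^ 3 * (d 3%nat * l ^ 3)
         + Cconj v4 * l ^ 4 * (d 4%nat * l ^ 4))%C by (unfold T; ring).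
      refine (tends_ext_from 0 _ _ _ _ K). intros N _. cbv beta. rewrite <- !average_scal, <- !average_plus.
      apply average_ext. intros u. unfold q. push_conj. ring. }
    apply (tends_Re_ge_0 _ _ Hlim). intros n. unfold average.
    rewrite <- RtoC_inv, re_scal_l by (apply not_0_INR; lia).
    apply Rmult_le_pos; [left; apply Rinv_0_lt_compat, lt_0_INR; lia|]. apply Re_Csum_ge_0. intros k.
    rewrite <- Cmult_assoc, <- Cmod_sqr, re_scal_r. apply Rmult_le_pos; [|apply pow2_ge_0]. left. apply Hp.
    rewrite Cmod_mult, Cmod_R, (Cmod_circle _ : Cmod (node _ _) = 1), Rabs_pos_eq; lra. }
  assert (L := le_limit_at_1 (fun l => - Re (T l)) 0).
  assert (E : toeplitz c v0 v1 v2 v3 v4 = T 1).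
  { unfold T, d, toeplitz, shift. rewrite Hb0, !Hb. ring. }
  rewrite E. cut (- Re (T 1) <= 0); [lra|]. apply L; [|intros l Hl; specialize (HT l Hl); lra].
  assert (ET : forall l, - Re (T l) = - (Re (Cconj v0 * d 0%nat)%C + l ^ 2 * Re (Cconj v1 * d 1%nat)%C
    + l ^ 4 * Re (Cconj v2 * d 2%nat)%C + l ^ 6 * Re (Cconj v3 * d 3%nat)%C + l ^ 8 * Re (Cconj v4 * d 4%nat)%C)).
  { intros l. unfold T. rewrite !re_plus, <- !RtoC_pow, !re_scal_l. reflexivity. }
  apply continuity_pt_ext with (1 := fun l => eq_sym (ET l)). reg.
Qed.

Lemma functional_choice {A B : Type} (P : A -> B -> Prop) : (forall x, exists y, P x y) -> exists f, forall x, P x (f x).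
Proof.
  intros H. exists (fun x => proj1_sig (constructive_indefinite_description _ (H x))).
  intros x. apply proj2_sig.
Qed.

(* By Cauchy's estimate the coefficients of the F k form Cauchy sequences. *)
Lemma ps_on_limit (A : nat -> nat -> C) (r : R) (F : nat -> C -> C) (f : C -> C) : 0 < r ->
  (forall k, ps_on (A k) r (F k)) ->
  (forall p e, 0 < p < r -> 0 < e -> exists K, forall k z, (K <= k)%nat -> Cmod z <= p -> Cmod (F k z - f z) <= e) ->
  exists a, ps_on a r f.
Proof.
  intros Hr HA Hu.
  assert (HC : forall p e, 0 < p < r -> 0 < e -> exists K, forall k m n, (K <= k)%nat -> (K <= m)%nat ->
    Cmod (A k n - A m n) * p ^ n <= e).
  { intros p e Hp He. destruct (Hu p (e / 2) Hp) as [K HK]; [lra|]. exists K. intros k m n Hk Hm.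
    apply (cauchy_estimate (fun n => A k n + (-(1)) * A m n)%C r (fun z => F k z + (-(1)) * F m z)%C) with (n := n) (p := p) (M := e) in Hp.
    - replace (A k n - A m n)%C with (A k n + - (1) * A m n)%C by ring. exact Hp.
    - intros z Hz. apply ps_plus; [|apply ps_scal]; apply HA, Hz.
    - intros z Hz. replace (F k z + - (1) * F m z)%C with (F k z - F m z)%C by ring.
      eapply Rle_trans; [apply (Cmod_triang3 _ (f z))|]. rewrite (Cmod_minus_sym (f z)).
      assert (B1 := HK k z Hk ltac:(lra)). assert (B2 := HK m z Hm ltac:(lra)). lra. }
  assert (HL : forall n, exists l, tends (fun k => A k n) l).
  { intros n. apply tends_Cauchy. intros e He. assert (Hpn : 0 < (r / 2) ^ n) by (apply pow_lt; lra).
    destruct (HC (r / 2) (e * (r / 2) ^ n)) as [K HK]; [lra | apply Rmult_lt_0_compat; lra|].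
    exists K. intros k m Hk Hm. specialize (HK k m n Hk Hm). apply Rmult_le_reg_r with (1 := Hpn), HK. }
  destruct (functional_choice _ HL) as [a Ha]. exists a. intros z Hz.
  set (p := (Cmod z + r) / 2). pose proof (Cmod_ge_0 z). assert (Hp : 0 < p < r) by (unfold p; lra).
  set (t := Cmod z / p). assert (Htp : t * p = Cmod z) by (unfold t; field; lra).
  assert (Hzp : Cmod z < p) by (unfold p; lra). assert (Ht : 0 <= t < 1) by (split; nra).
  (* Chosen so that the geometric bound d / (1 - t) for the difference of the two series is e /
     4. *)
  intros e He. set (d := e * (1 - t) / 4). assert (Hd : 0 < d) by (unfold d; apply Rdiv_lt_0_compat; [apply Rmult_lt_0_compat|]; lra).
  destruct (HC p d Hp Hd) as [K1 HK1]. destruct (Hu p (e / 4) Hp) as [K2 HK2]; [lra|].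
  set (K := (K1 + K2)%nat). specialize (HK2 K z ltac:(lia) ltac:(lra)).
  assert (HK : forall n, Cmod (a n - A K n) * p ^ n <= d).
  { intros n. assert (Hpn : 0 < p ^ n) by (apply pow_lt; lra).
    apply Rmult_le_reg_r with (/ p ^ n); [apply Rinv_0_lt_compat; lra|]. rewrite Rmult_assoc, Rinv_r, Rmult_1_r by lra.
    eapply tends_Cmod_le; [apply Ha|]. exists K1. intros k Hk. specialize (HK1 k K n Hk ltac:(lia)).
    apply Rmult_le_reg_r with (p ^ n); [lra|]. rewrite Rmult_assoc, Rinv_l, Rmult_1_r by lra. exact HK1. }
  destruct (HA K z Hz (e / 4)) as [N HN]; [lra|]. exists N. intros n Hn. specialize (HN n Hn).
  assert (T := Csum_tail_geom (fun k => (a k - A K k) * z ^ k)%C d t Ht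
    (ps_term_bound (fun k => a k - A K k)%C d p t z ltac:(lra) HK ltac:(lra)) 0 n).
  simpl in T. rewrite Rmult_1_r in T.
  replace (d / (1 - t)) with (e / 4) in T by (unfold d; field; lra).
  assert (ES : (Csum (fun k => a k * z ^ k) n - Csum (fun k => A K k * z ^ k) n)%C = (Csum (fun k => (a k - A K k) * z ^ k) n - 0)%C).
  { replace (Csum (fun k => a k * z ^ k) n)%C with (Csum (fun k => (a k - A K k) * z ^ k + A K k * z ^ k) n)%C
      by (apply Csum_ext; intros; ring). rewrite Csum_plus. ring. }
  rewrite <- ES in T.
  pose proof (Cmod_triang3 (Csum (fun k => a k * z ^ k)%C n) (Csum (fun k => A K k * z ^ k)%C n) (f z)).
  pose proof (Cmod_triang3 (Csum (fun k => A K k * z ^ k)%C n) (F K z) (f z)). lra.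
Qed.

(** * Closure properties of functions given by power series *)

Definition analytic_on (r : R) (f : C -> C) : Prop := exists a, ps_on a r f.

Lemma analytic_limit (r : R) (F : nat -> C -> C) (f : C -> C) : 0 < r -> (forall k, analytic_on r (F k)) ->
  (forall p e, 0 < p < r -> 0 < e -> exists K, forall k z, (K <= k)%nat -> Cmod z <= p -> Cmod (F k z - f z) <= e) ->
  analytic_on r f.
Proof.
  intros Hr HA Hu. destruct (functional_choice _ HA) as [A HA']. eapply ps_on_limit; eassumption.
Qed.

Lemma analytic_plus r f g : analytic_on r f -> analytic_on r g -> analytic_on r (fun z => f z + g z)%C.
Proof. intros [a Ha] [b Hb]. eexists. intros z Hz. apply ps_plus; [apply Ha | apply Hb]; exact Hz. Qed.

Lemma analytic_scal r c f : analytic_on r f -> analytic_on r (fun z => c * f z)%C.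
Proof. intros [a Ha]. eexists. intros z Hz. apply ps_scal, Ha, Hz. Qed.

Lemma analytic_times_id r f : analytic_on r f -> analytic_on r (fun z => z * f z)%C.
Proof. intros [a Ha]. eexists. intros z Hz. apply ps_shift, Ha, Hz. Qed.

Lemma analytic_const r c : analytic_on r (fun _ => c).
Proof.
  exists (fun n => match n with O => c | _ => 0%C end). intros z _.
  apply (tends_ext_from 1 (fun _ => c)); [|apply tends_const]. intros [|n] Hn; [lia|].
  rewrite Csum_shift, (Csum_ext _ (fun _ => 0%C)), Csum_zero; [simpl; ring|]. intros; simpl; ring.
Qed.

Lemma analytic_ext r f g : (forall z, f z = g z) -> analytic_on r f -> analytic_on r g.
Proof. intros E [a Ha]. exists a. intros z Hz. rewrite <- E. apply Ha, Hz. Qed.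

Lemma ps_on_bounded a r f p : ps_on a r f -> 0 < p < r -> exists M, 0 <= M /\ forall z, Cmod z <= p -> Cmod (f z) <= M.
Proof.
  intros H Hp. destruct (ps_on_uniform a r f p 1 H Hp Rlt_0_1) as [N HN].
  destruct (ps_on_coefficient_bound a r f p H ltac:(lra)) as [M HM].
  assert (HM0 : 0 <= M) by (specialize (HM O); pose proof (Cmod_ge_0 (a O)); simpl in HM; lra).
  assert (0 <= INR N) by apply pos_INR.
  exists (1 + INR N * M). split; [nra|]. intros z Hz.
  replace (f z) with ((f z - Csum (fun k => a k * z ^ k) N) + Csum (fun k => a k * z ^ k) N)%C by ring.
  apply Cmod_triangle_le; [apply HN; [lia | exact Hz]|]. apply Cmod_Csum_le. intros k _.
  assert (T := ps_term_bound a M p 1 z ltac:(lra) HM ltac:(lra) k). rewrite pow1, Rmult_1_r in T. exact T.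
Qed.

(** Replacing f by its Taylor polynomials leaves only sums, scalings and multiplications by z; the
    product is their locally uniform limit. This bypasses the Cauchy product of series. *)
Lemma analytic_mult r f g : 0 < r -> analytic_on r f -> analytic_on r g -> analytic_on r (fun z => f z * g z)%C.
Proof.
  intros Hr [a Ha] [b Hb].
  apply (analytic_limit r (fun N z => Csum (fun k => a k * z ^ k) N * g z)%C); [exact Hr| |].
  (* The coefficients are generalized for a Horner-style induction, which splits off the constant
     term and shifts the rest. *)
  - assert (HP : forall (N : nat) (h : nat -> C) , analytic_on r (fun z => Csum (fun k => h k * z ^ k) N * g z)%C).
    { induction N as [|N IH]; intros h.
      - apply (analytic_ext r (fun _ => 0%C)); [intros z; simpl; ring | apply analytic_const].
      - apply (analytic_ext r (fun z => h O * g z + z * (Csum (fun k => h (S k) * z ^ k) N * g z))%C).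
        + intros z. rewrite Csum_shift. replace (Csum (fun k => h (S k) * z ^ S k) N)%C
            with (z * Csum (fun k => h (S k) * z ^ k) N)%C; [simpl; ring|].
          rewrite <- Csum_scal. apply Csum_ext. intros; simpl; ring.
        + apply analytic_plus; [apply analytic_scal; exists b; exact Hb | apply analytic_times_id, IH]. }
    intros N. apply HP.
  - intros p e Hp He. destruct (ps_on_bounded b r g p Hb Hp) as [M [HM0 HM]].
    destruct (ps_on_uniform a r f p (e / (M + 1)) Ha Hp) as [N0 HN]; [apply Rdiv_lt_0_compat; lra|].
    exists N0. intros k z Hk Hz. specialize (HN k z Hk Hz). specialize (HM z Hz).
    match goal with |- Cmod ?x <= e => replace x with (- (f z - Csum (fun k => a k * z ^ k) k) * g z)%C by ring end.
    rewrite Cmod_mult, Cmod_opp.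
    apply Rle_trans with (e / (M + 1) * (M + 1)); [|right; field; lra].
    apply Rmult_le_compat; try apply Cmod_ge_0; lra.
Qed.

(** Taylor polynomials of f composed with g are analytic. They converge uniformly because the values
    of g stay in a disc of radius p < R0. *)
Lemma analytic_comp r R0 f g : 0 < r -> analytic_on r g -> analytic_on R0 f ->
  (exists p, 0 < p < R0 /\ forall z, Cmod z < r -> Cmod (g z) <= p) -> analytic_on r (fun z => f (g z)).
Proof.
  intros Hr Hg [a Ha] (p & Hp & Hgp).
  apply (analytic_limit r (fun N z => Csum (fun k => a k * g z ^ k) N)%C); [exact Hr| |].
  - assert (Hpow : forall k, analytic_on r (fun z => g z ^ k)%C).
    { induction k as [|k IH]; [exact (analytic_const r 1)|]. exact (analytic_mult r g _ Hr Hg IH). }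
    induction k as [|k IH]; [exact (analytic_const r 0)|].
    exact (analytic_plus r _ _ IH (analytic_scal r (a k) _ (Hpow k))).
  - intros q e Hq He. destruct (ps_on_uniform a R0 f p e Ha Hp He) as [N0 HN]. exists N0. intros k z Hk Hz.
    rewrite Cmod_minus_sym. apply HN; [exact Hk|]. apply Hgp. lra.
Qed.

(** * Complex derivatives *)

(** A quadratic error is stronger than differentiability. Power series satisfy it, and both the
    complex derivative and real derivatives along lines follow by direct estimates. *)
Definition has_derivative (f : C -> C) (z l : C) : Prop :=
  exists K d, 0 <= K /\ 0 < d /\ forall h, Cmod h < d -> Cmod (f (z + h)%C - f z - h * l) <= K * Cmod h ^ 2.

Lemma has_derivative_is_derive f z l : has_derivative f z l -> @is_derive C_AbsRing C_NormedModule f z l.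
Proof.
  intros (K & d & HK & Hd & H). split; [apply (is_linear_scal_l (K := C_AbsRing) (V := C_NormedModule))|].
  intros x Hx. rewrite <- (is_filter_lim_locally_unique (K := C_AbsRing) (V := AbsRing_NormedModule C_AbsRing) z x Hx). clear x Hx. intros eps.
  assert (He : 0 < Rmin d (eps / (K + 1))).
  { apply Rmin_case; [exact Hd|]. apply Rdiv_lt_0_compat; [apply cond_pos | lra]. }
  exists (mkposreal _ He).
  change (forall y : C, Cmod (y - z) < Rmin d (eps / (K + 1)) ->
    Cmod (f y - f z - (y - z) * l) <= eps * Cmod (y - z)).
  intros y Hy.
  assert (H1 := Rlt_le_trans _ _ _ Hy (Rmin_l _ _)). assert (H2 := Rlt_le_trans _ _ _ Hy (Rmin_r _ _)).
  specialize (H (y - z)%C H1). replace (z + (y - z))%C with y in H by ring.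
  eapply Rle_trans; [exact H|]. pose proof (Cmod_ge_0 (y - z)).
  apply Rmult_lt_compat_l with (r := K + 1) in H2; [|lra].
  replace ((K + 1) * (eps / (K + 1))) with (pos eps) in H2 by (field; lra). nra.
Qed.

Lemma has_derivative_C_derive f z l : has_derivative f z l -> C_derive f z = l.
Proof. intros H. apply is_C_derive_unique, has_derivative_is_derive, H. Qed.

(** Each of the n terms of 1 + u + ... + u^(n-1) is at least u^n. This absorbs the polynomial
    factors that differentiation creates. *)
Lemma INR_mult_pow_le u n : 0 <= u < 1 -> INR n * u ^ n <= / (1 - u).
Proof.
  intros Hu. assert (H : INR n * u ^ n * (1 - u) <= 1 - u ^ n).
  { induction n as [|n IH]; [simpl; lra|]. rewrite S_INR. simpl. assert (0 <= u ^ n) by (apply pow_le; lra).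
    assert (u ^ n <= 1) by (rewrite <- (pow1 n); apply pow_incr; lra).
    assert (IH' := Rmult_le_compat_l u _ _ (proj1 Hu) IH). assert (u * u ^ n <= 1) by nra.
    assert (0 <= (1 - u) * (1 - u * u ^ n)) by (apply Rmult_le_pos; lra). lra. }
  assert (0 <= u ^ n) by (apply pow_le; lra).
  apply Rmult_le_reg_r with (1 - u); [lra|]. rewrite Rinv_l by lra. lra.
Qed.

(** Here and in [Cpow_taylor_le] a power of p multiplies the left side instead of lowering the
    exponent on the right, so small n need no separate treatment. *)
Lemma Cpow_diff_le z h p n : 0 <= p -> Cmod z <= p -> Cmod (z + h) <= p ->
  Cmod ((z + h) ^ n - z ^ n) * p <= INR n * p ^ n * Cmod h.
Proof.
  intros Hp Hz Hzh. pose proof (Cmod_ge_0 h). induction n as [|n IH].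
  - simpl. replace (1 - 1)%C with (RtoC 0) by ring. rewrite Cmod_0. lra.
  - replace ((z + h) ^ S n - z ^ S n)%C with ((z + h) * ((z + h) ^ n - z ^ n) + h * z ^ n)%C by (simpl; ring).
    rewrite S_INR. eapply Rle_trans; [apply Rmult_le_compat_r; [exact Hp | apply Cmod_triangle]|].
    rewrite !Cmod_mult, Cmod_pow. assert (Cmod z ^ n <= p ^ n) by (apply pow_incr; split; [apply Cmod_ge_0 | lra]).
    assert (Cmod (z + h) * (Cmod ((z + h) ^ n - z ^ n) * p) <= p * (INR n * p ^ n * Cmod h)).
    { apply Rmult_le_compat; try assumption; [apply Cmod_ge_0 | apply Rmult_le_pos; [apply Cmod_ge_0 | exact Hp]]. }
    assert (Cmod h * Cmod z ^ n * p <= Cmod h * p ^ n * p) by (apply Rmult_le_compat_r; [exact Hp|]; apply Rmult_le_compat_l; lra).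
    simpl. lra.
Qed.

Lemma Cpow_taylor_le z h p n : 0 <= p -> Cmod z <= p -> Cmod (z + h) <= p ->
  Cmod ((z + h) ^ n - z ^ n - h * (INR n * z ^ pred n)) * p ^ 2 <= INR n ^ 2 * p ^ n * Cmod h ^ 2.
Proof.
  intros Hp Hz Hzh. pose proof (Cmod_ge_0 h). induction n as [|n IH].
  - simpl. replace (1 - 1 - h * (0 * 1))%C with (RtoC 0) by ring. rewrite Cmod_0. lra.
  - assert (E : ((z + h) ^ S n - z ^ S n - h * (INR (S n) * z ^ pred (S n)))%C
      = (z * ((z + h) ^ n - z ^ n - h * (INR n * z ^ pred n)) + h * ((z + h) ^ n - z ^ n))%C).
    { rewrite S_INR, RtoC_plus. destruct n as [|n]; [simpl; ring|]. simpl pred. simpl Cpow. ring. }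
    rewrite E, S_INR. eapply Rle_trans; [apply Rmult_le_compat_r; [apply pow2_ge_0 | apply Cmod_triangle]|].
    rewrite !Cmod_mult. set (Rn := Cmod ((z + h) ^ n - z ^ n - h * (INR n * z ^ pred n))) in *.
    assert (D := Cpow_diff_le z h p n Hp Hz Hzh). set (Dn := Cmod ((z + h) ^ n - z ^ n)) in *.
    assert (0 <= Rn) by apply Cmod_ge_0. assert (0 <= p ^ n) by (apply pow_le; exact Hp).
    assert (0 <= INR n) by apply pos_INR.
    assert (A1 : Cmod z * (Rn * p ^ 2) <= p * (INR n ^ 2 * p ^ n * Cmod h ^ 2)).
    { apply Rmult_le_compat; try assumption; [apply Cmod_ge_0 | apply Rmult_le_pos; [assumption | apply pow2_ge_0]]. }
    assert (A2 : (Cmod h * p) * (Dn * p) <= (Cmod h * p) * (INR n * p ^ n * Cmod h)).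
    { apply Rmult_le_compat_l; [apply Rmult_le_pos; lra | exact D]. }
    assert (A3 : 0 <= (INR n + 1) * (p * p ^ n * Cmod h ^ 2)).
    { repeat apply Rmult_le_pos; lra. }
    simpl pow in *. lra.
Qed.

Definition derivative_coefficients (a : nat -> C) (n : nat) : C := (INR (S n) * a (S n))%C.

Lemma ps_on_derivative a r f : ps_on a r f ->
  ps_on (derivative_coefficients a) r (C_derive f) /\ forall z, Cmod z < r -> has_derivative f z (C_derive f z).
Proof.
  intros H.
  assert (HD : forall z, Cmod z < r -> exists l, ps (derivative_coefficients a) z l /\ has_derivative f z l).
  { intros z Hz. pose proof (Cmod_ge_0 z). set (p := (2 * Cmod z + r) / 3). set (q := (p + r) / 2).
    assert (Hp : 0 < p < q) by (unfold q, p; lra). assert (Hq : q < r) by (unfold q, p; lra).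
    assert (Hzp : Cmod z < p) by (unfold p; lra).
    destruct (ps_on_coefficient_bound a r f q H) as [M HM]; [lra|].
    assert (HM0 : 0 <= M) by (specialize (HM O); pose proof (Cmod_ge_0 (a O)); simpl in HM; lra).
    set (t := p / q). assert (Htq : t * q = p) by (unfold t; field; lra). assert (Ht : 0 <= t < 1) by (split; nra).
    (* With t = u^4, two of the four factors u^n in t^n absorb n^2, and (u^2)^n remains as geometric
       decay. *)
    set (u := sqrt (sqrt t)). assert (Hu4 : t = u ^ 4).
    { unfold u. replace (sqrt (sqrt t) ^ 4) with (Rsqr (Rsqr (sqrt (sqrt t)))) by (unfold Rsqr; ring).
      rewrite Rsqr_sqrt by apply sqrt_pos. rewrite Rsqr_sqrt; lra. }
    assert (Hu0 : 0 <= u) by apply sqrt_pos. assert (Hu1 : 0 <= u < 1) by (split; [|destruct (Rlt_dec u 1)]; [assumption|assumption|];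
      assert (1 <= u ^ 4) by (apply pow_R1_Rle; lra); lra).
    set (B := M * (/ (1 - u) * / (1 - u))).
    assert (Hiu : 0 < / (1 - u)) by (apply Rinv_0_lt_compat; lra).
    assert (HB : forall n, Cmod (a n) * (INR n ^ 2 * p ^ n) <= B * (u ^ 2) ^ n).
    { intros n. replace (p ^ n) with (q ^ n * t ^ n) by (rewrite <- Rpow_mult_distr; f_equal; lra).
      rewrite Hu4, <- pow_mult. replace (u ^ (4 * n)) with (u ^ n * u ^ n * (u ^ 2) ^ n)
        by (rewrite <- pow_mult, <- !pow_add; f_equal; lia).
      assert (0 <= (u ^ 2) ^ n) by (apply pow_le, pow2_ge_0). pose proof (INR_mult_pow_le u n Hu1) as HI.
      assert (0 <= u ^ n) by (apply pow_le; lra). pose proof (pos_INR n). pose proof (Cmod_ge_0 (a n)).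
      assert (0 <= q ^ n) by (apply pow_le; lra).
      replace (Cmod (a n) * (INR n ^ 2 * (q ^ n * (u ^ n * u ^ n * (u ^ 2) ^ n))))
        with (Cmod (a n) * q ^ n * ((INR n * u ^ n) * (INR n * u ^ n)) * (u ^ 2) ^ n) by ring.
      unfold B. apply Rmult_le_compat_r; [assumption|]. apply Rmult_le_compat; [| |apply HM|].
      - apply Rmult_le_pos; assumption.
      - repeat apply Rmult_le_pos; assumption.
      - apply Rmult_le_compat; try assumption; apply Rmult_le_pos; assumption. }
    assert (Hu2 : 0 <= u ^ 2 < 1) by nra.
    assert (HB0 : 0 <= B) by (unfold B; repeat apply Rmult_le_pos; lra).
    assert (HD : forall n, Cmod (derivative_coefficients a n) * p ^ n <= B / p).
    { intros n. unfold derivative_coefficients. rewrite Cmod_mult, Cmod_R, Rabs_pos_eq by apply pos_INR.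
      apply Rmult_le_reg_r with p; [lra|]. replace (B / p * p) with B by (field; lra).
      specialize (HB (S n)). assert (1 <= INR (S n)) by (rewrite S_INR; pose proof (pos_INR n); lra).
      assert ((u ^ 2) ^ S n <= 1) by (rewrite <- (pow1 (S n)); apply pow_incr; lra).
      assert (0 <= Cmod (a (S n)) * p ^ S n) by (apply Rmult_le_pos; [apply Cmod_ge_0 | apply pow_le; lra]).
      set (X := Cmod (a (S n)) * p ^ S n) in *.
      replace (INR (S n) * Cmod (a (S n)) * p ^ n * p) with (INR (S n) * X) by (unfold X; simpl pow; ring).
      replace (Cmod (a (S n)) * (INR (S n) ^ 2 * p ^ S n)) with (INR (S n) * (INR (S n) * X)) in HB by (unfold X; ring).
      assert (B * (u ^ 2) ^ S n <= B * 1) by (apply Rmult_le_compat_l; assumption).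
      assert (1 * (INR (S n) * X) <= INR (S n) * (INR (S n) * X)) by (apply Rmult_le_compat_r; nra). lra. }
    destruct (ps_converges _ _ p z (proj1 Hp) HD Hzp) as [l Hl]. exists l. split; [exact Hl|].
    set (K := B / (1 - u ^ 2) / p ^ 2).
    exists K, (p - Cmod z). split; [|split; [lra|]].
    { unfold K, Rdiv. repeat apply Rmult_le_pos; try lra; left; apply Rinv_0_lt_compat; nra. }
    intros h Hh. assert (Hzh : Cmod (z + h) <= p) by (eapply Rle_trans; [apply Cmod_triangle | lra]).
    (* The partial sums of f are taken one term longer than those of the derivative, so that the
       terms match degree by degree. *)
    assert (L := tends_plus _ _ _ _ (tends_succ _ _ (H (z + h)%C ltac:(lra)))
      (tends_plus _ _ _ _ (tends_scal (-(1)) _ _ (tends_succ _ _ (H z ltac:(lra)))) (tends_scal (- h) _ _ Hl))).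
    cbv beta in L.
    replace (f (z + h) - f z - h * l)%C with (f (z + h)%C + (- (1) * f z + - h * l) - 0)%C by ring.
    eapply tends_Cmod_le; [exact L|]. exists O. intros n _. cbv beta.
    assert (E : (Csum (fun k => a k * (z + h) ^ k) (S n) + (- (1) * Csum (fun k => a k * z ^ k) (S n)
        + - h * Csum (fun k => derivative_coefficients a k * z ^ k) n) - 0)%C
      = (Csum (fun k => a k * ((z + h) ^ k - z ^ k - h * (INR k * z ^ pred k))) (S n) - 0)%C).
    { rewrite (Csum_ext (fun k => a k * ((z + h) ^ k - z ^ k - h * (INR k * z ^ pred k)))%C
        (fun k => (a k * (z + h) ^ k + (- (1)) * (a k * z ^ k)) + (- h) * (INR k * a k * z ^ pred k))%C) by (intros; ring).
      rewrite !Csum_plus, !Csum_scal. rewrite (Csum_shift (fun k => INR k * a k * z ^ pred k)%C).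
      unfold derivative_coefficients. simpl pred. rewrite Cmult_0_l, Cmult_0_l. ring. }
    rewrite E. clear E L.
    assert (G := Csum_tail_geom (fun k => a k * ((z + h) ^ k - z ^ k - h * (INR k * z ^ pred k)))%C
      (B * Cmod h ^ 2 / p ^ 2) (u ^ 2) Hu2).
    replace (K * Cmod h ^ 2) with (B * Cmod h ^ 2 / p ^ 2 * (u ^ 2) ^ 0 / (1 - u ^ 2)) by (unfold K; simpl; field; split; nra).
    apply (fun P => G P O (S n)). intros k. rewrite Cmod_mult.
    assert (Hp2 : 0 < p ^ 2) by nra.
    apply Rmult_le_reg_r with (p ^ 2); [lra|].
    replace (B * Cmod h ^ 2 / p ^ 2 * (u ^ 2) ^ k * p ^ 2) with (B * (u ^ 2) ^ k * Cmod h ^ 2) by (field; lra).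
    assert (T := Cpow_taylor_le z h p k ltac:(lra) ltac:(lra) Hzh).
    apply Rle_trans with (Cmod (a k) * (INR k ^ 2 * p ^ k * Cmod h ^ 2)).
    - rewrite Rmult_assoc. apply Rmult_le_compat_l; [apply Cmod_ge_0 | exact T].
    - specialize (HB k). assert (0 <= Cmod h ^ 2) by apply pow2_ge_0.
      rewrite <- !Rmult_assoc in *. apply Rmult_le_compat_r; assumption. }
  split; intros z Hz; destruct (HD z Hz) as (l & H1 & H2); rewrite (has_derivative_C_derive _ _ _ H2); assumption.
Qed.

(** The factor conj d turns the directional derivative d l into |d|^2 l, so only the real part of
    the derivative matters. *)
Lemma has_derivative_line F z0 d l : forall t : R, has_derivative F (z0 + t * d)%C l ->
  derivable_pt_lim (fun s : R => Re (Cconj d * F (z0 + s * d))%C) t (Cmod d ^ 2 * Re l).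
Proof.
  intros t (K & e & HK & He & H) eps Heps. pose proof (Cmod_ge_0 d).
  set (m := Cmod d + 1). set (K' := m * (K * m ^ 2) + 1). assert (Hm : 1 <= m) by (unfold m; lra).
  assert (HK' : 0 < K') by (unfold K'; assert (0 <= m * (K * m ^ 2)) by (repeat apply Rmult_le_pos; nra); lra).
  assert (Hde : 0 < Rmin (e / m) (eps / K')) by (apply Rmin_case; apply Rdiv_lt_0_compat; lra).
  exists (mkposreal _ Hde). intros s Hs0 Hs. simpl in Hs.
  assert (H1 := Rlt_le_trans _ _ _ Hs (Rmin_l _ _)). assert (H2 := Rlt_le_trans _ _ _ Hs (Rmin_r _ _)).
  assert (Hsd : Cmod (s * d) <= Rabs s * m) by (rewrite Cmod_mult, Cmod_R; apply Rmult_le_compat_l; [apply Rabs_pos | unfold m; lra]).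
  apply Rmult_lt_compat_r with (r := m) in H1; [|lra]. replace (e / m * m) with e in H1 by (field; lra).
  specialize (H (s * d)%C ltac:(lra)).
  replace (z0 + t * d + s * d)%C with (z0 + (t + s)%R * d)%C in H by (rewrite RtoC_plus; ring).
  set (X := (F (z0 + (t + s)%R * d) - F (z0 + t * d) - s * d * l)%C) in H.
  assert (E : (Re (Cconj d * F (z0 + (t + s)%R * d))%C - Re (Cconj d * F (z0 + t * d))%C) / s - Cmod d ^ 2 * Re l
    = Re (Cconj d * X)%C / s).
  { assert (E0 : Re (Cconj d * X)%C = Re (Cconj d * F (z0 + (t + s)%R * d))%C - Re (Cconj d * F (z0 + t * d))%C - s * (Cmod d ^ 2 * Re l)).
    { rewrite <- !re_scal_l, Cmod_sqr. unfold X. generalize (F (z0 + (t + s)%R * d)%C), (F (z0 + t * d)%C).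
      intros [x1 y1] [x2 y2]. destruct d, l. unfold Re, Cconj, Cmult, Cminus, Cplus, Copp, RtoC; simpl. ring. }
    rewrite E0. field. exact Hs0. }
  rewrite E. unfold Rdiv. rewrite Rabs_mult, Rabs_inv. pose proof (Rabs_pos_lt s Hs0) as Hsp.
  apply Rmult_lt_reg_r with (Rabs s); [exact Hsp|]. rewrite Rmult_assoc, Rinv_l, Rmult_1_r by lra.
  eapply Rle_lt_trans; [apply re_le_Cmod|]. rewrite Cmod_mult, Cmod_conj.
  assert (Cmod (s * d) ^ 2 <= (Rabs s * m) ^ 2) by (apply pow_incr; split; [apply Cmod_ge_0 | exact Hsd]).
  apply Rle_lt_trans with (m * (K * (Rabs s * m) ^ 2)).
  - apply Rmult_le_compat; try apply Cmod_ge_0; [unfold m; lra|]. eapply Rle_trans; [exact H|]. apply Rmult_le_compat_l; assumption.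
  - apply Rmult_lt_compat_r with (r := K') in H2; [|lra]. replace (eps / K' * K') with eps in H2 by (field; lra).
    replace (m * (K * (Rabs s * m) ^ 2)) with ((K' - 1) * Rabs s * Rabs s) by (unfold K'; ring).
    apply Rmult_lt_compat_r with (r := Rabs s) in H2; nra.
Qed.

(** The Noshiro-Warschawski argument: the mean value theorem along the segment from z0 to z0 + d. It
    serves for f, giving univalence, and for z f', giving Re f' > 0. *)
Lemma Re_increment_gt_0 F F' (z0 d : C) : d <> 0 ->
  (forall t : R, 0 <= t <= 1 -> has_derivative F (z0 + t * d)%C (F' (z0 + t * d)%C) /\ 0 < Re (F' (z0 + t * d)%C)) ->
  0 < Re (Cconj d * (F (z0 + d) - F z0))%C.
Proof.
  intros Hd H. set (g := fun s : R => Re (Cconj d * F (z0 + s * d))%C).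
  destruct (MVT_cor2 g (fun t => Cmod d ^ 2 * Re (F' (z0 + t * d)%C)) 0 1 Rlt_0_1) as (c & Hc & Hc01).
  { intros t Ht. apply has_derivative_line, H, Ht. }
  destruct (H c ltac:(lra)) as [_ Hpos]. apply Cmod_gt_0 in Hd.
  assert (0 < Cmod d ^ 2 * Re (F' (z0 + c * d)%C)) by (apply Rmult_lt_0_compat; nra).
  replace (Re (Cconj d * (F (z0 + d) - F z0))%C) with (g 1 - g 0); [lra|]. unfold g.
  replace (z0 + 1 * d)%C with (z0 + d)%C by ring. replace (z0 + 0 * d)%C with z0 by ring.
  generalize (F (z0 + d)%C), (F z0). intros [x1 y1] [x2 y2]. destruct d. unfold Re, Cconj, Cmult, Cminus, Cplus, Copp; simpl. ring.
Qed.

(** * Coefficients of the inverse function *)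

(** The point 0 is excluded because the functions concerned are quotients by z. *)
Definition tends_at_0 (F : C -> C) (l : C) : Prop :=
  forall e, 0 < e -> exists d, 0 < d /\ forall z : C, z <> 0%C -> Cmod z < d -> Cmod (F z - l) < e.

Lemma tends_at_0_const c : tends_at_0 (fun _ => c) c.
Proof.
  intros e He. exists 1. split; [lra|]. intros z _ _. replace (c - c)%C with (RtoC 0) by ring. now rewrite Cmod_0.
Qed.

Lemma tends_at_0_id : tends_at_0 (fun z => z) 0.
Proof.
  intros e He. exists e. split; [exact He|]. intros z _ Hz. replace (z - 0)%C with z by ring. exact Hz.
Qed.

Lemma tends_at_0_plus F G a b : tends_at_0 F a -> tends_at_0 G b -> tends_at_0 (fun z => F z + G z)%C (a + b)%C.
Proof.
  intros H1 H2 e He. destruct (H1 (e / 2)) as (d1 & Hd1 & P1); [lra|]. destruct (H2 (e / 2)) as (d2 & Hd2 & P2); [lra|].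
  exists (Rmin d1 d2). split; [apply Rmin_case; assumption|]. intros z Hz Hzd.
  specialize (P1 z Hz (Rlt_le_trans _ _ _ Hzd (Rmin_l _ _))). specialize (P2 z Hz (Rlt_le_trans _ _ _ Hzd (Rmin_r _ _))).
  replace (F z + G z - (a + b))%C with ((F z - a) + (G z - b))%C by ring. eapply Rle_lt_trans; [apply Cmod_triangle|]. lra.
Qed.

Lemma tends_at_0_mult F G a b : tends_at_0 F a -> tends_at_0 G b -> tends_at_0 (fun z => F z * G z)%C (a * b)%C.
Proof.
  intros H1 H2 e He. pose proof (Cmod_ge_0 a). pose proof (Cmod_ge_0 b).
  set (k := Cmod a + Cmod b + 1). set (e' := Rmin 1 (e / (2 * k))).
  assert (Hk : 0 < k) by (unfold k; lra).
  assert (He' : 0 < e') by (apply Rmin_case; [lra | apply Rdiv_lt_0_compat; lra]).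
  assert (He1 : e' <= 1) by apply Rmin_l. assert (He2 : e' * k <= e / 2).
  { apply Rle_trans with (e / (2 * k) * k); [apply Rmult_le_compat_r; [lra | apply Rmin_r] | right; field; lra]. }
  destruct (H1 e' He') as (d1 & Hd1 & P1). destruct (H2 e' He') as (d2 & Hd2 & P2).
  exists (Rmin d1 d2). split; [apply Rmin_case; assumption|]. intros z Hz Hzd.
  specialize (P1 z Hz (Rlt_le_trans _ _ _ Hzd (Rmin_l _ _))). specialize (P2 z Hz (Rlt_le_trans _ _ _ Hzd (Rmin_r _ _))).
  replace (F z * G z - a * b)%C with ((F z - a) * (G z - b) + (a * (G z - b) + (F z - a) * b))%C by ring.
  pose proof (Cmod_ge_0 (F z - a)). pose proof (Cmod_ge_0 (G z - b)).
  eapply Rle_lt_trans; [apply Cmod_triangle_le; [apply Rle_refl | apply Cmod_triangle_le; apply Rle_refl]|].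
  rewrite !Cmod_mult.
  assert (Cmod (F z - a) * Cmod (G z - b) <= e' * 1) by (apply Rmult_le_compat; lra).
  assert (Cmod a * Cmod (G z - b) <= Cmod a * e') by (apply Rmult_le_compat_l; lra).
  assert (Cmod (F z - a) * Cmod b <= e' * Cmod b) by (apply Rmult_le_compat_r; lra).
  unfold k in *. lra.
Qed.

Lemma tends_at_0_unique F a b r : 0 < r -> tends_at_0 F a -> (forall z : C, z <> 0%C -> Cmod z < r -> F z = b) -> a = b.
Proof.
  intros Hr H E. apply Cmod_small_eq. intros e He. destruct (H e He) as (d & Hd & P).
  set (m := Rmin r d / 2). assert (Hm : 0 < Rmin r d) by (apply Rmin_case; assumption).
  assert (Em : Cmod m = m) by (rewrite Cmod_R; apply Rabs_pos_eq; unfold m; lra).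
  pose proof (Rmin_l r d). pose proof (Rmin_r r d). assert (Hm0 : RtoC m <> 0) by (apply RtoC_neq; unfold m; lra).
  specialize (P m Hm0 ltac:(rewrite Em; unfold m; lra)). rewrite E in P by (try assumption; rewrite Em; unfold m; lra).
  rewrite Cmod_minus_sym. lra.
Qed.

Lemma tends_at_0_comp F f l r : 0 < r -> tends_at_0 F l -> tends_at_0 f 0 ->
  (forall z : C, z <> 0%C -> Cmod z < r -> f z <> 0%C) -> tends_at_0 (fun z => F (f z)) l.
Proof.
  intros Hr HF Hf Hn e He. destruct (HF e He) as (d & Hd & P). destruct (Hf d Hd) as (d' & Hd' & P').
  exists (Rmin r d'). split; [apply Rmin_case; assumption|]. intros z Hz Hzd.
  specialize (P' z Hz (Rlt_le_trans _ _ _ Hzd (Rmin_r _ _))). replace (f z - 0)%C with (f z) in P' by ring.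
  apply P; [|exact P']. apply Hn; [exact Hz | exact (Rlt_le_trans _ _ _ Hzd (Rmin_l _ _))].
Qed.

(** Silent at 0, unlike [ps_on], and therefore stable under removing the constant term and dividing
    by z. *)
Definition punctured_ps (a : nat -> C) (r : R) (f : C -> C) : Prop :=
  forall z : C, z <> 0%C -> Cmod z < r -> ps a z (f z).

Lemma punctured_ps_tends a r f : 0 < r -> punctured_ps a r f -> tends_at_0 f (a O).
Proof.
  intros Hr H. set (p := r / 2).
  assert (Ep : Cmod p = p) by (rewrite Cmod_R; apply Rabs_pos_eq; unfold p; lra).
  assert (Hp : RtoC p <> 0) by (apply RtoC_neq; unfold p; lra).
  destruct (ps_coefficient_bound a p (f p)) as [M HM]; [apply H; [exact Hp | rewrite Ep; unfold p; lra]|]. rewrite Ep in HM.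
  assert (HM0 : 0 <= M) by (specialize (HM O); pose proof (Cmod_ge_0 (a O)); simpl in HM; lra).
  intros e He. set (t := Rmin (1 / 2) (e / (4 * (M + 1)))).
  assert (Ht : 0 < t) by (apply Rmin_case; [lra | apply Rdiv_lt_0_compat; lra]).
  assert (Ht1 : t <= 1 / 2) by apply Rmin_l. assert (Ht2 : t * (M + 1) <= e / 4).
  { apply Rle_trans with (e / (4 * (M + 1)) * (M + 1)); [apply Rmult_le_compat_r; [lra | apply Rmin_r] | right; field; lra]. }
  assert (Hp0 : 0 < p < r) by (unfold p; lra).
  exists (t * p). split; [apply Rmult_lt_0_compat; lra|]. intros z Hz Hzt.
  assert (T := ps_tail a M p t z (f z) ltac:(lra) ltac:(lra) HM ltac:(lra) ltac:(apply H; [exact Hz | nra]) 1).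
  replace (Csum (fun k => a k * z ^ k) 1)%C with (a O) in T by (simpl; ring).
  eapply Rle_lt_trans; [exact T|]. rewrite pow_1. apply Rmult_lt_reg_r with (1 - t); [lra|].
  unfold Rdiv. rewrite Rmult_assoc, Rinv_l by lra. nra.
Qed.

Definition quotient (f : C -> C) (c : C) (z : C) : C := ((f z - c) / z)%C.

Lemma quotientE f c (z : C) : z <> 0%C -> f z = (c + z * quotient f c z)%C.
Proof. intros Hz. unfold quotient. field. exact Hz. Qed.

Lemma punctured_ps_quotient a r f : punctured_ps a r f -> punctured_ps (fun n => a (S n)) r (quotient f (a O)).
Proof. intros H z Hz Hzr. apply ps_decr; [exact Hz | apply H; assumption]. Qed.

Lemma ps_on_punctured a r f : ps_on a r f -> punctured_ps a r f.
Proof. intros H z _ Hz. apply H, Hz. Qed.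

(** The difference of the series represents 0. Its leading coefficient is the limit at 0, hence 0,
    and division by z brings up the next one. *)
Lemma ps_on_unique a b r f : 0 < r -> ps_on a r f -> ps_on b r f -> forall n, a n = b n.
Proof.
  intros Hr Ha Hb.
  assert (H0 : forall n d, punctured_ps d r (fun _ => 0%C) -> d n = 0%C).
  { induction n as [|n IH]; intros d Hd.
    - apply (tends_at_0_unique (fun _ => 0%C) (d O) 0 r Hr); [eapply punctured_ps_tends; eassumption | reflexivity].
    - assert (E : d O = 0%C).
      { apply (tends_at_0_unique (fun _ => 0%C) (d O) 0 r Hr); [eapply punctured_ps_tends; eassumption | reflexivity]. }
      apply (IH (fun n => d (S n))). intros z Hz Hzr. assert (Q := punctured_ps_quotient _ _ _ Hd z Hz Hzr).
      unfold quotient in Q. rewrite E in Q. replace ((0 - 0) / z)%C with (RtoC 0) in Q by (field; exact Hz). exact Q. }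
  intros n. specialize (H0 n (fun n => a n + (-(1)) * b n)%C). apply Ceq_minus. replace (a n - b n)%C with (a n + - (1) * b n)%C by ring.
  apply H0. intros z _ Hz. replace (RtoC 0) with (f z + - (1) * f z)%C by ring. apply ps_plus; [|apply ps_scal]; auto.
Qed.

Lemma ps_on_at_0 a r f : 0 < r -> ps_on a r f -> f 0 = a O.
Proof. intros Hr H. apply (tends_unique _ _ _ (H 0 ltac:(rewrite Cmod_0; exact Hr)) (ps_at_0 a)). Qed.

Ltac tends0 := repeat first [assumption | apply tends_at_0_const | apply tends_at_0_id
  | apply tends_at_0_plus | apply tends_at_0_mult].

Lemma Cmult_cancel (z x : C) : z <> 0%C -> (z * x)%C = 0%C -> x = 0%C.
Proof. intros Hz E. replace x with (/ z * (z * x))%C by (field; exact Hz). rewrite E. ring. Qed.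

(* Each relation is the value at 0 of an identity obtained from g (f z) = z by
   dividing by z once more. *)
Lemma inverse_relations (a A : nat -> C) (f g : C -> C) (r : R) :
  ps_on a 1 f -> a 0%nat = 0%C -> a 1%nat = 1%C -> 0 < r -> ps_on A r g -> A 0%nat = 0%C -> A 1%nat = 1%C ->
  (forall z, Cmod z < 1 -> g (f z) = z) ->
  (a 2%nat + A 2%nat = 0 /\
   a 3%nat + 2 * a 2%nat * A 2%nat + A 3%nat = 0 /\
   a 4%nat + (2 * a 3%nat + a 2%nat * a 2%nat) * A 2%nat + 3 * a 2%nat * A 3%nat + A 4%nat = 0 /\
   a 5%nat + (2 * a 4%nat + 2 * a 2%nat * a 3%nat) * A 2%nat + (3 * a 3%nat + 3 * a 2%nat * a 2%nat) * A 3%nat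
     + 4 * a 2%nat * A 4%nat + A 5%nat = 0)%C.
Proof.
  intros Hf a0 a1 Hr Hg A0 A1 Hgf.
  assert (Hn : forall z : C, z <> 0%C -> Cmod z < 1 -> f z <> 0%C).
  { intros z Hz Hz1 E. apply Hz. rewrite <- (Hgf z Hz1), E, (ps_on_at_0 A r g Hr Hg). exact A0. }
  assert (P0 := ps_on_punctured _ _ _ Hf). assert (P1 := punctured_ps_quotient _ _ _ P0).
  assert (P2 := punctured_ps_quotient _ _ _ P1). assert (P3 := punctured_ps_quotient _ _ _ P2).
  assert (P4 := punctured_ps_quotient _ _ _ P3). assert (P5 := punctured_ps_quotient _ _ _ P4).
  assert (Q0 := ps_on_punctured _ _ _ Hg). assert (Q1 := punctured_ps_quotient _ _ _ Q0).
  assert (Q2 := punctured_ps_quotient _ _ _ Q1). assert (Q3 := punctured_ps_quotient _ _ _ Q2).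
  assert (Q4 := punctured_ps_quotient _ _ _ Q3). assert (Q5 := punctured_ps_quotient _ _ _ Q4).
  (* [p1], ..., [p5] and [q1], ..., [q5] are the Taylor remainders of f and g, each divided by the
     matching power of its variable; their limits at 0 are the coefficients. *)
  set (p1 := quotient f _) in *. set (p2 := quotient p1 _) in *. set (p3 := quotient p2 _) in *.
  set (p4 := quotient p3 _) in *. set (p5 := quotient p4 _) in *.
  set (q1 := quotient g _) in *. set (q2 := quotient q1 _) in *. set (q3 := quotient q2 _) in *.
  set (q4 := quotient q3 _) in *. set (q5 := quotient q4 _) in *.
  assert (T0 := punctured_ps_tends _ _ _ Rlt_0_1 P0). rewrite a0 in T0.
  apply punctured_ps_tends in P1, P2, P3, P4, P5; try lra.
  assert (HC : forall F l, tends_at_0 F l -> tends_at_0 (fun z => F (f z)) l).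
  { intros F l HF. apply (tends_at_0_comp F f l 1); [lra | exact HF | exact T0 | exact Hn]. }
  apply punctured_ps_tends, HC in Q2, Q3, Q4, Q5; try lra.
  rewrite a1 in P1.
  assert (E : forall z : C, z <> 0%C -> Cmod z < 1 ->
    f z = (z * p1 z)%C /\ p1 z = (1 + z * p2 z)%C /\ p2 z = (a 2%nat + z * p3 z)%C /\ p3 z = (a 3%nat + z * p4 z)%C
    /\ p4 z = (a 4%nat + z * p5 z)%C /\ z = (f z + f z * f z * q2 (f z))%C /\ q2 (f z) = (A 2%nat + f z * q3 (f z))%C
    /\ q3 (f z) = (A 3%nat + f z * q4 (f z))%C /\ q4 (f z) = (A 4%nat + f z * q5 (f z))%C).
  { intros z Hz Hz1. assert (Hfz := Hn z Hz Hz1).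
    assert (K0 : f z = (a 0%nat + z * p1 z)%C) by (apply quotientE; exact Hz).
    assert (K1 : g (f z) = (A 0%nat + f z * q1 (f z))%C) by (apply quotientE; exact Hfz).
    assert (K2 : q1 (f z) = (A 1%nat + f z * q2 (f z))%C) by (apply quotientE; exact Hfz).
    rewrite Hgf, A0, K2, A1 in K1 by exact Hz1. rewrite a0, Cplus_0_l in K0.
    split; [exact K0|]. split; [rewrite <- a1; apply quotientE, Hz|].
    split; [apply quotientE, Hz|]. split; [apply quotientE, Hz|]. split; [apply quotientE, Hz|].
    split; [etransitivity; [exact K1 | ring]|].
    repeat split; apply quotientE, Hfz. }
  assert (S1 : forall z : C, z <> 0%C -> Cmod z < 1 -> (p2 z + p1 z * p1 z * q2 (f z))%C = 0%C).
  { intros z Hz Hz1. destruct (E z Hz Hz1) as (E0 & E1 & _ & _ & _ & E5 & _).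
    apply (Cmult_cancel z); [exact Hz|]. apply (Cmult_cancel z); [exact Hz|].
    replace (z * (z * (p2 z + p1 z * p1 z * q2 (f z))))%C
      with (z * (1 + z * p2 z) + (z * p1 z) * (z * p1 z) * q2 (f z) - z)%C by ring.
    rewrite <- E1, <- E0, <- E5. ring. }
  assert (R1 : (a 2%nat + A 2%nat)%C = 0%C).
  (* Here and in the later relations the factors 1 and 0 are the limits of [p1] and of z, put where
     [tends0] produces them. *)
  { replace (a 2%nat + A 2%nat)%C with (a 2%nat + 1 * 1 * A 2%nat)%C by ring.
    refine (tends_at_0_unique _ _ _ 1 Rlt_0_1 _ S1). tends0. }
  assert (S2 : forall z : C, z <> 0%C -> Cmod z < 1 ->
    (p3 z + (2 * p2 z + z * (p2 z * p2 z)) * A 2%nat + p1 z * p1 z * p1 z * q3 (f z))%C = 0%C).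
  { intros z Hz Hz1. assert (S := S1 z Hz Hz1). destruct (E z Hz Hz1) as (E0 & E1 & E2 & _ & _ & _ & E6 & _).
    apply (Cmult_cancel z); [exact Hz|]. rewrite E6, E0 in S. rewrite <- S.
    transitivity (a 2%nat + z * p3 z + p1 z * p1 z * (A 2%nat + z * p1 z * q3 (z * p1 z)))%C; [|rewrite <- E2; reflexivity].
    rewrite E0, !E1.
    replace (a 2%nat) with (- A 2%nat)%C by (replace (a 2%nat) with ((a 2%nat + A 2%nat) - A 2%nat)%C by ring; rewrite R1; ring).
    ring. }
  assert (R2 : (a 3%nat + 2 * a 2%nat * A 2%nat + A 3%nat)%C = 0%C).
  { replace (a 3%nat + 2 * a 2%nat * A 2%nat + A 3%nat)%C
      with (a 3%nat + (2 * a 2%nat + 0 * (a 2%nat * a 2%nat)) * A 2%nat + 1 * 1 * 1 * A 3%nat)%C by ring.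
    refine (tends_at_0_unique _ _ _ 1 Rlt_0_1 _ S2). tends0. }
  assert (S3 : forall z : C, z <> 0%C -> Cmod z < 1 ->
    (p4 z + (2 * p3 z + p2 z * p2 z) * A 2%nat + (3 * p2 z + z * (3 * p2 z * p2 z + z * (p2 z * p2 z * p2 z))) * A 3%nat
     + p1 z * p1 z * p1 z * p1 z * q4 (f z))%C = 0%C).
  { intros z Hz Hz1. assert (S := S2 z Hz Hz1). destruct (E z Hz Hz1) as (E0 & E1 & E2 & E3 & _ & _ & _ & E7 & _).
    apply (Cmult_cancel z); [exact Hz|]. rewrite E7, E0 in S. rewrite <- S.
    transitivity (a 3%nat + z * p4 z + (2 * (a 2%nat + z * p3 z) + z * (p2 z * p2 z)) * A 2%nat
      + p1 z * p1 z * p1 z * (A 3%nat + z * p1 z * q4 (z * p1 z)))%C; [|rewrite <- E2, <- E3; reflexivity].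
    rewrite E0, !E1.
    replace (a 3%nat) with (- (2 * a 2%nat * A 2%nat + A 3%nat))%C
      by (replace (a 3%nat) with ((a 3%nat + 2 * a 2%nat * A 2%nat + A 3%nat) - (2 * a 2%nat * A 2%nat + A 3%nat))%C by ring; rewrite R2; ring).
    ring. }
  assert (R3 : (a 4%nat + (2 * a 3%nat + a 2%nat * a 2%nat) * A 2%nat + 3 * a 2%nat * A 3%nat + A 4%nat)%C = 0%C).
  { replace (a 4%nat + (2 * a 3%nat + a 2%nat * a 2%nat) * A 2%nat + 3 * a 2%nat * A 3%nat + A 4%nat)%C
      with (a 4%nat + (2 * a 3%nat + a 2%nat * a 2%nat) * A 2%nat + (3 * a 2%nat + 0 * (3 * a 2%nat * a 2%nat
         + 0 * (a 2%nat * a 2%nat * a 2%nat))) * A 3%nat + 1 * 1 * 1 * 1 * A 4%nat)%C by ring.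
    refine (tends_at_0_unique _ _ _ 1 Rlt_0_1 _ S3). tends0. }
  assert (S4 : forall z : C, z <> 0%C -> Cmod z < 1 ->
    (p5 z + (2 * p4 z + p3 z * (p2 z + a 2%nat)) * A 2%nat + (3 * p3 z + 3 * (p2 z * p2 z) + z * (p2 z * p2 z * p2 z)) * A 3%nat
     + p2 z * (4 + z * (6 * p2 z + z * (4 * p2 z * p2 z + z * (p2 z * p2 z * p2 z)))) * A 4%nat
     + p1 z * p1 z * p1 z * p1 z * p1 z * q5 (f z))%C = 0%C).
  { intros z Hz Hz1. assert (S := S3 z Hz Hz1). destruct (E z Hz Hz1) as (E0 & E1 & E2 & E3 & E4 & _ & _ & _ & E8).
    apply (Cmult_cancel z); [exact Hz|]. rewrite E8, E0 in S. rewrite <- S.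
    transitivity (a 4%nat + z * p5 z + (2 * (a 3%nat + z * p4 z) + (a 2%nat + z * p3 z) * p2 z) * A 2%nat
      + (3 * (a 2%nat + z * p3 z) + z * (3 * p2 z * p2 z + z * (p2 z * p2 z * p2 z))) * A 3%nat
      + p1 z * p1 z * p1 z * p1 z * (A 4%nat + z * p1 z * q5 (z * p1 z)))%C; [|rewrite <- E2, <- E3, <- E4; reflexivity].
    (* Uses p2^2 = a_2^2 + z p3 (p2 + a_2), which isolates the constant term and explains the factor
       p2 + a_2 in [S4]. *)
    replace ((a 2%nat + z * p3 z) * p2 z)%C with (a 2%nat * (a 2%nat + z * p3 z) + z * p3 z * p2 z)%C
      by (rewrite <- E2; transitivity ((a 2%nat + z * p3 z) * p2 z)%C; [ring | rewrite <- E2; reflexivity]).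
    rewrite E0, !E1.
    replace (a 4%nat) with (- ((2 * a 3%nat + a 2%nat * a 2%nat) * A 2%nat + 3 * a 2%nat * A 3%nat + A 4%nat))%C
      by (replace (a 4%nat) with ((a 4%nat + (2 * a 3%nat + a 2%nat * a 2%nat) * A 2%nat + 3 * a 2%nat * A 3%nat + A 4%nat)
         - ((2 * a 3%nat + a 2%nat * a 2%nat) * A 2%nat + 3 * a 2%nat * A 3%nat + A 4%nat))%C by ring; rewrite R3; ring).
    ring. }
  split; [exact R1|]. split; [exact R2|]. split; [exact R3|].
  replace (a 5%nat + (2 * a 4%nat + 2 * a 2%nat * a 3%nat) * A 2%nat + (3 * a 3%nat + 3 * a 2%nat * a 2%nat) * A 3%nat
     + 4 * a 2%nat * A 4%nat + A 5%nat)%C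
    with (a 5%nat + (2 * a 4%nat + a 3%nat * (a 2%nat + a 2%nat)) * A 2%nat
     + (3 * a 3%nat + 3 * (a 2%nat * a 2%nat) + 0 * (a 2%nat * a 2%nat * a 2%nat)) * A 3%nat
     + a 2%nat * (4 + 0 * (6 * a 2%nat + 0 * (4 * a 2%nat * a 2%nat + 0 * (a 2%nat * a 2%nat * a 2%nat)))) * A 4%nat
     + 1 * 1 * 1 * 1 * 1 * A 5%nat)%C by ring.
  refine (tends_at_0_unique _ _ _ 1 Rlt_0_1 _ S4). tends0.
Qed.

(** The relations are triangular in A_2, ..., A_5. Substituting their solution gives the identity
    H_3(1)(f^{-1}) = H_3(1)(f) - (a_3 - a_2^2)^3. *)
Lemma Hankel3_inverse_hankel (a A c : nat -> C) : A 1%nat = 1%C ->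
  (a 2%nat + A 2%nat = 0 /\
   a 3%nat + 2 * a 2%nat * A 2%nat + A 3%nat = 0 /\
   a 4%nat + (2 * a 3%nat + a 2%nat * a 2%nat) * A 2%nat + 3 * a 2%nat * A 3%nat + A 4%nat = 0 /\
   a 5%nat + (2 * a 4%nat + 2 * a 2%nat * a 3%nat) * A 2%nat + (3 * a 3%nat + 3 * a 2%nat * a 2%nat) * A 3%nat
     + 4 * a 2%nat * A 4%nat + A 5%nat = 0)%C ->
  a 2%nat = (c 1%nat / 2)%C -> a 3%nat = (2 * c 2%nat / 9)%C -> a 4%nat = (c 3%nat / 8)%C -> a 5%nat = (2 * c 4%nat / 25)%C ->
  Hankel3 A = inverse_hankel c.
Proof.
  intros H1 (R1 & R2 & R3 & R4) E2 E3 E4 E5. rewrite (Hankel3E A H1). unfold inverse_hankel. cbv zeta.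
  rewrite <- E2, <- E3, <- E4, <- E5. clear E2 E3 E4 E5.
  revert R1 R2 R3 R4.
  generalize (a 2%nat), (a 3%nat), (a 4%nat), (a 5%nat), (A 2%nat), (A 3%nat), (A 4%nat), (A 5%nat).
  intros a2 a3 a4 a5 A2 A3 A4 A5 R1 R2 R3 R4.
  assert (solve : forall x y : C, (x + y)%C = 0%C -> y = (- x)%C).
  { intros x y E. replace y with ((x + y) - x)%C by ring. rewrite E. ring. }
  apply solve in R1, R2, R3, R4. subst A5 A4 A3 A2. ring.
Qed.

(** * Local inversion, the class R_1 and the extremal function *)

(** Since a_1 = 1, only terms of degree at least 2 remain in f - id, and they have small Lipschitz
    constant near 0. This is the contraction behind [picard]. *)
Lemma near_identity a f : ps_on a 1 f -> a 1%nat = 1%C -> exists p, 0 < p < 1 /\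
  forall z z', Cmod z <= p -> Cmod z' <= p -> Cmod (f z - f z' - (z - z')) <= / 2 * Cmod (z - z').
Proof.
  intros H a1. destruct (ps_on_coefficient_bound a 1 f (/ 2) H) as [M HM]; [lra|].
  assert (HM0 : 0 <= M) by (specialize (HM O); pose proof (Cmod_ge_0 (a O)); simpl in HM; lra).
  (* t <= 1/4 makes (k + 2) t^k at most 2 / 2^k; t M <= 1/16 brings the resulting Lipschitz constant
     8 t M down to 1/2. *)
  set (t := Rmin (/ 4) (/ (16 * (M + 1)))).
  assert (Ht : 0 < t) by (apply Rmin_case; apply Rinv_0_lt_compat; lra).
  assert (Ht1 : t <= / 4) by apply Rmin_l. assert (Ht2 : t * (M + 1) <= / 16).
  { apply Rle_trans with (/ (16 * (M + 1)) * (M + 1)); [apply Rmult_le_compat_r; [lra | apply Rmin_r] | right; field; lra]. }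
  set (p := t * / 2). assert (Hp : 0 < p <= / 8) by (unfold p; lra).
  exists p. split; [lra|]. intros z z' Hz Hz'.
  set (h := (z - z')%C). pose proof (Cmod_ge_0 h). assert (Hzh : (z' + h)%C = z) by (unfold h; ring).
  set (u := fun k => (a (S (S k)) * (z ^ S (S k) - z' ^ S (S k)))%C).
  assert (Hu : forall k, Cmod (u k) <= 4 * M * t * Cmod h * (/ 2) ^ k).
  { intros k. unfold u. rewrite Cmod_mult.
    assert (D := Cpow_diff_le z' h p (S (S k)) ltac:(lra) Hz' ltac:(rewrite Hzh; exact Hz)). rewrite Hzh in D.
    assert (Hk : INR (S (S k)) * t ^ k <= 2 * (/ 2) ^ k).
    { assert (Hk1 : INR (S (S k)) * (/ 2) ^ k <= 2).
      { clear. induction k as [|k IH]; [simpl; lra|].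
        rewrite (S_INR (S (S k))). simpl pow.
        assert (0 < (/ 2) ^ k) by (apply pow_lt; lra).
        assert (1 <= INR (S (S k))) by (rewrite !S_INR; pose proof (pos_INR k); lra).
        set (x := (/ 2) ^ k) in *. assert (1 * x <= INR (S (S k)) * x) by (apply Rmult_le_compat_r; lra). lra. }
      assert (t ^ k <= (/ 2) ^ k * (/ 2) ^ k) by (rewrite <- Rpow_mult_distr; apply pow_incr; lra).
      assert (0 < (/ 2) ^ k) by (apply pow_lt; lra). pose proof (pos_INR (S (S k))).
      apply Rle_trans with (INR (S (S k)) * ((/ 2) ^ k * (/ 2) ^ k)); [apply Rmult_le_compat_l; assumption|].
      rewrite <- Rmult_assoc. apply Rmult_le_compat_r; lra. }
    apply Rmult_le_reg_r with p; [lra|]. specialize (HM (S (S k))).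
    apply Rle_trans with (Cmod (a (S (S k))) * (INR (S (S k)) * p ^ S (S k) * Cmod h)).
    { rewrite Rmult_assoc. apply Rmult_le_compat_l; [apply Cmod_ge_0 | exact D]. }
    replace (p ^ S (S k)) with ((/ 2) ^ S (S k) * (t * t * t ^ k)) by (unfold p; rewrite Rpow_mult_distr; simpl; ring).
    replace (Cmod (a (S (S k))) * (INR (S (S k)) * ((/ 2) ^ S (S k) * (t * t * t ^ k)) * Cmod h))
      with ((Cmod (a (S (S k))) * (/ 2) ^ S (S k)) * (INR (S (S k)) * t ^ k) * (t * t * Cmod h)) by ring.
    replace (4 * M * t * Cmod h * (/ 2) ^ k * p) with (M * (2 * (/ 2) ^ k) * (t * t * Cmod h)) by (unfold p; field).
    assert (0 <= t * t * Cmod h) by (repeat apply Rmult_le_pos; lra).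
    apply Rmult_le_compat_r; [assumption|]. apply Rmult_le_compat; try assumption.
    - apply Rmult_le_pos; [apply Cmod_ge_0 | apply pow_le; lra].
    - apply Rmult_le_pos; [apply pos_INR | apply pow_le; lra]. }
  assert (Hlim := tends_plus _ _ _ _ (H z ltac:(lra)) (tends_scal (-(1)) _ _ (H z' ltac:(lra)))).
  replace (f z - f z' - h)%C with (f z + - (1) * f z' - h)%C by ring.
  eapply tends_Cmod_le; [exact Hlim|]. exists 2%nat. intros n Hn. destruct n as [|[|n]]; try lia. cbv beta.
  assert (E : (Csum (fun k => a k * z ^ k) (S (S n)) + - (1) * Csum (fun k => a k * z' ^ k) (S (S n)) - h)%C = (Csum u (0 + n) - Csum u 0)%C).
  { rewrite <- Csum_scal, <- Csum_plus, !Csum_shift, a1.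
    rewrite (Csum_ext (fun k => a (S (S k)) * z ^ S (S k) + - (1) * (a (S (S k)) * z' ^ S (S k)))%C u) by (intros; unfold u; ring).
    simpl. unfold h. ring. }
  rewrite E. eapply Rle_trans; [apply (Csum_tail_geom u _ (/ 2) ltac:(lra) Hu)|]. simpl.
  replace (4 * M * t * Cmod h * 1 / (1 - / 2)) with (8 * (t * M) * Cmod h) by field.
  apply Rmult_le_compat_r; lra.
Qed.

(** Iterates v -> w + (v - f v), whose fixed points are the solutions of f v = w. *)
Fixpoint picard (f : C -> C) (k : nat) (w : C) : C :=
  match k with O => 0%C | S k => (w + (picard f k w - f (picard f k w)))%C end.

Lemma local_inverse a f : ps_on a 1 f -> a 0%nat = 0%C -> a 1%nat = 1%C -> exists A g r,
  0 < r /\ ps_on A r g /\ A 0%nat = 0%C /\ A 1%nat = 1%C /\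
  forall w, Cmod w < r -> Cmod (g w) < 1 /\ f (g w) = w.
Proof.
  intros H a0 a1. destruct (near_identity a f H a1) as (p & Hp & HL).
  assert (f0 : f 0 = 0%C) by (rewrite (ps_on_at_0 a 1 f Rlt_0_1 H); exact a0).
  (* An iterate in |v| <= p is sent to modulus at most |w| + p / 2, which stays below p when |w| < p
     / 2. *)
  set (r := p / 2). assert (Hr : 0 < r) by (unfold r; lra).
  assert (HG : forall k w, Cmod w < r -> Cmod (picard f k w) <= p).
  { intros k w Hw. induction k as [|k IH]; simpl; [rewrite Cmod_0; lra|].
    specialize (HL (picard f k w) 0 IH ltac:(rewrite Cmod_0; lra)). rewrite f0 in HL.
    replace (f (picard f k w) - 0 - (picard f k w - 0))%C with (- (picard f k w - f (picard f k w)))%C in HL by ring.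
    rewrite Cmod_opp in HL. replace (picard f k w - 0)%C with (picard f k w) in HL by ring.
    eapply Rle_trans; [apply Cmod_triangle|]. unfold r in Hw. lra. }
  assert (HS : forall k w, Cmod w < r -> Cmod (picard f (S k) w - picard f k w) <= p * (/ 2) ^ k).
  { intros k w Hw. induction k as [|k IH].
    - simpl. rewrite f0. replace (w + (0 - 0) - 0)%C with w by ring. unfold r in Hw. lra.
    - replace (picard f (S (S k)) w - picard f (S k) w)%C
        with (- (f (picard f (S k) w) - f (picard f k w) - (picard f (S k) w - picard f k w)))%C by (simpl; ring).
      rewrite Cmod_opp. eapply Rle_trans; [apply HL; apply HG, Hw|]. simpl pow. lra. }
  assert (HC : forall w, Cmod w < r -> forall m n, Cmod (picard f (m + n) w - picard f m w) <= 2 * p * (/ 2) ^ m).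
  { intros w Hw m n. set (u := fun k => (picard f (S k) w - picard f k w)%C).
    assert (Hsum : forall k, Csum u k = picard f k w) by (induction k as [|k IH]; [reflexivity|]; simpl Csum; rewrite IH; unfold u; ring).
    rewrite <- !Hsum. eapply Rle_trans; [apply (Csum_tail_geom u p (/ 2) ltac:(lra))|right; field].
    intros k. apply HS, Hw. }
  assert (Hex : forall w, exists l, Cmod w < r -> tends (fun k => picard f k w) l).
  { intros w. destruct (Rlt_dec (Cmod w) r) as [Hw|Hw]; [|exists 0; tauto].
    destruct (tends_Cauchy (fun k => picard f k w)) as [l Hl]; [|exists l; auto].
    intros e He. destruct (pow_small (4 * p) (/ 2) e) as [N HN]; [lra | lra | exact He|]. exists N. intros n m Hn Hm.
    specialize (HN N (le_n N)). assert (X1 := HC w Hw N (n - N)%nat). assert (X2 := HC w Hw N (m - N)%nat).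
    replace (N + (n - N))%nat with n in X1 by lia. replace (N + (m - N))%nat with m in X2 by lia.
    pose proof (Cmod_triang3 (picard f n w) (picard f N w) (picard f m w)) as T.
    rewrite (Cmod_minus_sym (picard f N w)) in T. lra. }
  destruct (functional_choice _ Hex) as [g Hg].
  assert (HU : forall w k, Cmod w < r -> Cmod (picard f k w - g w) <= 2 * p * (/ 2) ^ k).
  { intros w k Hw. rewrite Cmod_minus_sym. eapply tends_Cmod_le; [apply Hg, Hw|]. exists k. intros n Hn.
    replace n with (k + (n - k))%nat by lia. apply HC, Hw. }
  assert (Hgp : forall w, Cmod w < r -> Cmod (g w) <= p).
  { intros w Hw. assert (K := tends_Cmod_le _ _ 0 p (Hg w Hw)). replace (g w - 0)%C with (g w) in K by ring. apply K.
    exists O. intros n _. replace (picard f n w - 0)%C with (picard f n w) by ring. apply HG, Hw. }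
  assert (Hfg : forall w, Cmod w < r -> f (g w) = w).
  { intros w Hw. apply Cmod_small_eq. intros e He. destruct (pow_small (4 * p) (/ 2) e) as [N HN]; [lra | lra | exact He|].
    specialize (HN N (le_n N)).
    replace (f (g w) - w)%C with ((f (g w) - f (picard f N w) - (g w - picard f N w)) + (g w - picard f (S N) w))%C by (simpl; ring).
    eapply Rle_trans; [apply Cmod_triangle|].
    assert (X1 := HL (g w) (picard f N w) (Hgp w Hw) (HG N w Hw)). assert (X2 := HU w N Hw). assert (X3 := HU w (S N) Hw).
    rewrite Cmod_minus_sym in X2. rewrite Cmod_minus_sym in X3. simpl pow in X3. lra. }
  assert (HA : analytic_on r g).
  { apply (analytic_limit r (picard f)); [exact Hr| |].
    - assert (Hid : analytic_on r (fun w => w)).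
      { apply (analytic_ext r (fun w => w * 1)%C); [intros; ring|]. apply analytic_times_id, analytic_const. }
      induction k as [|k IH]; [exact (analytic_const r 0)|].
      apply (analytic_ext r (fun w => w + (picard f k w + (-(1)) * f (picard f k w)))%C); [intros; simpl; ring|].
      apply analytic_plus; [exact Hid|]. apply analytic_plus; [exact IH|]. apply analytic_scal.
      apply (analytic_comp r 1 f (picard f k)); [exact Hr | exact IH | exists a; exact H |].
      exists p. split; [exact Hp|]. intros; apply HG; assumption.
    - intros q e Hq He. destruct (pow_small (2 * p) (/ 2) e) as [N HN]; [lra | lra | exact He|]. exists N. intros k z Hk Hz.
      eapply Rle_trans; [apply HU; lra | apply HN, Hk]. }
  destruct HA as [A HA]. exists A, g, r.
  assert (g0 : g 0 = 0%C).
  { apply Cmod_eq_0. assert (H0 : Cmod 0 < r) by (rewrite Cmod_0; exact Hr).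
    assert (X := HL (g 0) 0 (Hgp _ H0) ltac:(rewrite Cmod_0; lra)). rewrite Hfg, f0 in X by exact H0.
    replace (0 - 0 - (g 0 - 0))%C with (- g 0)%C in X by ring. replace (g 0 - 0)%C with (g 0) in X by ring.
    rewrite Cmod_opp in X. pose proof (Cmod_ge_0 (g 0)). lra. }
  assert (A0 : A O = 0%C) by (rewrite <- (ps_on_at_0 A r g Hr HA); exact g0).
  split; [exact Hr|]. split; [exact HA|]. split; [exact A0|]. split; [|intros w Hw; split; [|apply Hfg, Hw]].
  2: { eapply Rle_lt_trans; [apply Hgp, Hw | lra]. }
  assert (Hn : forall w : C, w <> 0%C -> Cmod w < r -> g w <> 0%C).
  { intros w Hw Hwr E. apply Hw. rewrite <- (Hfg w Hwr), E. exact f0. }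
  assert (Q0 := ps_on_punctured _ _ _ HA). assert (Q1 := punctured_ps_quotient _ _ _ Q0).
  assert (P1 := punctured_ps_quotient _ _ _ (ps_on_punctured _ _ _ H)).
  apply punctured_ps_tends in Q0, Q1, P1; try lra. rewrite A0 in Q0. rewrite a1 in P1.
  (* The product of g(w) / w and f(g(w)) / g(w) is 1, and the two factors tend to A_1 and 1. *)
  replace (A 1%nat) with (A 1%nat * 1)%C by ring.
  refine (tends_at_0_unique _ _ _ r Hr (tends_at_0_mult _ _ _ _ Q1 (tends_at_0_comp _ g 1 r Hr P1 Q0 Hn)) _).
  intros w Hw Hwr. cbv beta. unfold quotient. rewrite Hfg, A0, a0 by exact Hwr. field. split; [apply Hn; assumption | exact Hw].
Qed.

(** * Functions of R_1: univalence, the bound and the inverse *)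

Lemma class_A_ps f : class_A f -> exists a, ps_on a 1 f /\ a 0%nat = 0%C /\ a 1%nat = 1%C.
Proof.
  intros (a & a0 & a1 & Ha). exists a. split; [|auto]. intros z Hz. apply is_pseries_ps, Ha, Hz.
Qed.

Definition convexity_coefficients (a : nat -> C) (n : nat) : C := (INR (S n) ^ 2 * a (S n))%C.

Lemma ps_on_convexity a r f : ps_on a r f ->
  ps_on (convexity_coefficients a) r (fun z => C_derive f z + z * C_derive (C_derive f) z)%C.
Proof.
  intros H. destruct (ps_on_derivative a r f H) as [H1 _]. destruct (ps_on_derivative _ r _ H1) as [H2 _].
  intros z Hz. refine (ps_ext _ _ _ _ _ (ps_plus _ _ _ _ _ (H1 z Hz) (ps_shift _ _ _ (H2 z Hz)))).
  intros [|n]; unfold convexity_coefficients, derivative_coefficients, shift; [simpl; ring|].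
  rewrite (S_INR (S n)), !RtoC_plus. ring.
Qed.

Lemma ps_on_z_derivative a r f : ps_on a r f ->
  ps_on (convexity_coefficients a) r (C_derive (fun u => u * C_derive f u)%C) /\
  forall z, Cmod z < r -> has_derivative (fun u => u * C_derive f u)%C z (C_derive (fun u => u * C_derive f u)%C z).
Proof.
  intros H. destruct (ps_on_derivative a r f H) as [H1 _].
  destruct (ps_on_derivative _ r _ (fun z Hz => ps_shift _ _ _ (H1 z Hz))) as [H2 H3]. split; [|exact H3].
  intros z Hz. refine (ps_ext _ _ _ _ _ (H2 z Hz)). intros n.
  unfold convexity_coefficients, derivative_coefficients, shift. ring.
Qed.

(** Both sides are sums of the same convergent series, which replaces the product rule. *)
Lemma z_derivativeE a f z : ps_on a 1 f -> Cmod z < 1 ->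
  C_derive (fun u => u * C_derive f u)%C z = (C_derive f z + z * C_derive (C_derive f) z)%C.
Proof.
  intros H Hz. destruct (ps_on_z_derivative a 1 f H) as [H1 _].
  exact (tends_unique _ _ _ (H1 z Hz) (ps_on_convexity a 1 f H z Hz)).
Qed.

(** For G = z f' one has Re G' > 0, and conj z (G(z) - G(0)) = |z|^2 f'(z). At z = 0 the segment
    degenerates, but there f' + z f'' is f' itself. *)
Lemma Re_derivative_gt_0 f z : class_R1 f -> Cmod z < 1 -> 0 < Re (C_derive f z).
Proof.
  intros [HA HR] Hz. destruct (class_A_ps f HA) as (a & Ha & a0 & a1).
  destruct (ps_on_derivative a 1 f Ha) as [H1 _].
  assert (HRpos : forall z, Cmod z < 1 -> 0 < Re (C_derive (fun u => u * C_derive f u)%C z)).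
  { intros u Hu. rewrite (z_derivativeE a f u Ha Hu). apply HR, Hu. }
  destruct (ps_on_z_derivative a 1 f Ha) as [_ H2].
  destruct (Ceq_dec z 0) as [->|Hz0].
  - specialize (HR 0 Hz). replace (C_derive f 0 + 0 * C_derive (C_derive f) 0)%C with (C_derive f 0) in HR by ring. exact HR.
  - set (G := fun u => (u * C_derive f u)%C) in *.
    assert (K : 0 < Re (Cconj z * (G (0 + z) - G 0))%C).
    { apply (Re_increment_gt_0 G (C_derive G)); [exact Hz0|]. intros t Ht.
      assert (Htz : Cmod (0 + t * z) < 1).
      { rewrite Cplus_0_l, Cmod_mult, Cmod_R, Rabs_pos_eq by lra. pose proof (Cmod_ge_0 z). nra. }
      split; [apply H2, Htz | apply HRpos, Htz]. }
    unfold G in K. rewrite Cplus_0_l in K.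
    replace (Cconj z * (z * C_derive f z - 0 * C_derive f 0))%C with (z * Cconj z * C_derive f z)%C in K by ring.
    rewrite <- Cmod_sqr, re_scal_l in K. pose proof (pow2_ge_0 (Cmod z)). nra.
Qed.

(** The disc is convex, so Re f' > 0 holds along the segment joining the two points and forces a
    nonzero increment. *)
Lemma class_R1_injective f z1 z2 : class_R1 f -> Cmod z1 < 1 -> Cmod z2 < 1 -> f z1 = f z2 -> z1 = z2.
Proof.
  intros H H1 H2 E. destruct (Ceq_dec z1 z2) as [|Hne]; [assumption|exfalso].
  destruct (class_A_ps f (proj1 H)) as (a & Ha & _). destruct (ps_on_derivative a 1 f Ha) as [_ HD].
  set (d := (z2 - z1)%C). assert (Hd : d <> 0%C).
  { unfold d. intros E0. apply Hne. symmetry. apply Ceq_minus, E0. }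
  assert (K : 0 < Re (Cconj d * (f (z1 + d) - f z1))%C).
  { apply (Re_increment_gt_0 f (C_derive f)); [exact Hd|]. intros t Ht.
    assert (Hz : Cmod (z1 + t * d) < 1).
    { unfold d. replace (z1 + t * (z2 - z1))%C with ((1 - t)%R * z1 + t * z2)%C by (rewrite RtoC_minus; ring).
      eapply Rle_lt_trans; [apply Cmod_triangle|]. rewrite !Cmod_mult, !Cmod_R, !Rabs_pos_eq by lra.
      destruct (Req_dec t 0) as [->|]; [lra|]. assert (0 < t) by lra. nra. }
    split; [apply HD, Hz | apply Re_derivative_gt_0; assumption]. }
  replace (z1 + d)%C with z2 in K by (unfold d; ring). rewrite E in K.
  replace (Cconj d * (f z2 - f z2))%C with (RtoC 0) in K by ring. rewrite re_RtoC in K. lra.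
Qed.

Definition caratheodory_coefficients (a : nat -> C) (n : nat) : C := (convexity_coefficients a n / 2)%C.

Lemma Hankel3_of_inverse (a A : nat -> C) (f g : C -> C) (r : R) :
  ps_on a 1 f -> a 0%nat = 0%C -> a 1%nat = 1%C -> 0 < r -> ps_on A r g -> A 0%nat = 0%C -> A 1%nat = 1%C ->
  (forall z, Cmod z < 1 -> g (f z) = z) -> Hankel3 A = inverse_hankel (caratheodory_coefficients a).
Proof.
  intros Hf a0 a1 Hr Hg A0 A1 Hgf. apply (Hankel3_inverse_hankel a A); [exact A1| | | | |].
  - eapply inverse_relations; eassumption.
  - unfold caratheodory_coefficients, convexity_coefficients. simpl INR. rewrite !RtoC_plus. Cfield.
  - unfold caratheodory_coefficients, convexity_coefficients. simpl INR. rewrite !RtoC_plus. Cfield.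
  - unfold caratheodory_coefficients, convexity_coefficients. simpl INR. rewrite !RtoC_plus. Cfield.
  - unfold caratheodory_coefficients, convexity_coefficients. simpl INR. rewrite !RtoC_plus. Cfield.
Qed.

Lemma class_R1_bound (f : C -> C) (A : nat -> C) : class_R1 f -> inverse_coefficients f A -> Cmod (Hankel3 A) <= 1 / 64.
Proof.
  intros HR (g & r & Hgf & Hr & _ & A0 & A1 & HA).
  destruct (class_A_ps f (proj1 HR)) as (a & Ha & a0 & a1).
  rewrite (Hankel3_of_inverse a A f g r); try assumption.
  2: { intros w Hw. apply is_pseries_ps, HA, Hw. }
  apply inverse_hankel_le_of_toeplitz.
  apply (toeplitz_ge_0 (convexity_coefficients a) _ _ (ps_on_convexity a 1 f Ha)).
  - unfold convexity_coefficients. rewrite a1. simpl. ring.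
  - intros n. unfold caratheodory_coefficients. Cfield.
  - intros z Hz. apply (proj2 HR), Hz.
Qed.

(** [inverse_coefficients] asks for g (f z) = z on the whole disc, while [local_inverse] controls
    small w only. The local inverse is extended by choosing preimages elsewhere in the image;
    univalence makes the two agree. *)
Lemma class_R1_inverse (f : C -> C) : class_R1 f -> exists A, inverse_coefficients f A.
Proof.
  intros HR. destruct (class_A_ps f (proj1 HR)) as (a & Ha & a0 & a1).
  destruct (local_inverse a f Ha a0 a1) as (A & g & r & Hr & HA & A0 & A1 & Hg). exists A.
  assert (Hex : forall w, exists z, (Cmod w < r -> z = g w) /\ forall u, Cmod u < 1 -> f u = w -> z = u).
  { intros w. destruct (Rlt_dec (Cmod w) r) as [Hw|Hw].
    - exists (g w). split; [reflexivity|]. intros u Hu E. destruct (Hg w Hw) as [X Y].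
      apply (class_R1_injective f); try assumption. congruence.
    - destruct (Classical_Prop.classic (exists u, Cmod u < 1 /\ f u = w)) as [(u & Hu & E)|Hn].
      + exists u. split; [tauto|]. intros v Hv E'. apply (class_R1_injective f); try assumption. congruence.
      + exists 0. split; [tauto|]. intros u Hu E. exfalso. eauto. }
  destruct (functional_choice _ Hex) as [G HG]. exists G, r.
  split; [intros z Hz; apply (HG (f z)); [exact Hz | reflexivity]|]. split; [exact Hr|].
  assert (HGg : forall w, Cmod w < r -> G w = g w) by (intros w; apply HG).
  split; [intros w Hw; rewrite HGg by exact Hw; apply Hg, Hw|].
  split; [exact A0|]. split; [exact A1|]. intros w Hw. rewrite HGg by exact Hw. apply is_pseries_ps, HA, Hw.
Qed.

(** * The extremal function *)

Definition extremal_convexity (n : nat) : C :=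
  match n with O => 1%C | _ => if Nat.eq_dec (n mod 3) 0 then 2%C else 0%C end.

Lemma one_minus_cube_neq_0 (z : C) : Cmod z < 1 -> (1 - z * z * z)%C <> 0%C.
Proof.
  intros Hz E. assert (E1 : (z * z * z)%C = 1%C) by (symmetry; apply Ceq_minus, E).
  apply (f_equal Cmod) in E1. rewrite !Cmod_mult, Cmod_1 in E1. pose proof (Cmod_ge_0 z).
  assert (Cmod z * Cmod z < 1) by nra. nra.
Qed.

(** The expansion 1 + 2 z^3 + 2 z^6 + ... is checked by multiplying with 1 - z^3: subtracting the
    threefold shift leaves coefficients that cancel from degree 4 on. *)
Lemma extremal_convexity_ps : ps_on extremal_convexity 1 (fun z => (1 + z * z * z) / (1 - z * z * z))%C.
Proof.
  intros z Hz.
  assert (HM : forall n, Cmod (extremal_convexity n) * 1 ^ n <= 2).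
  { intros n. rewrite pow1, Rmult_1_r. unfold extremal_convexity. destruct n; [rewrite Cmod_1; lra|].
    destruct (Nat.eq_dec _ 0); rewrite Cmod_R, Rabs_pos_eq; lra. }
  destruct (ps_converges _ 2 1 z Rlt_0_1 HM Hz) as [l Hl].
  assert (Hsh := ps_plus _ _ _ _ _ Hl (ps_scal (-(1)) _ _ _ (ps_shift _ _ _ (ps_shift _ _ _ (ps_shift _ _ _ Hl))))).
  assert (E : (l + - (1) * (z * (z * (z * l))))%C = (1 + z * z * z)%C).
  { apply (tends_unique _ _ _ Hsh). apply (tends_ext_from 4 (fun _ => (1 + z * z * z)%C)); [|apply tends_const].
    intros n Hn. replace n with (4 + (n - 4))%nat by lia. generalize (n - 4)%nat. clear. intros n.
    change (4 + n)%nat with (S (S (S (S n)))). rewrite !Csum_shift.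
    rewrite (Csum_ext _ (fun _ => 0%C)), Csum_zero.
    - simpl. ring.
    - intros k _. cbv [shift].
      replace (extremal_convexity (S (S (S (S k))))) with (extremal_convexity (S k)); [ring|].
      unfold extremal_convexity. replace (S (S (S (S k)))) with (S k + 1 * 3)%nat by lia. rewrite Nat.Div0.mod_add. reflexivity. }
  replace ((1 + z * z * z) / (1 - z * z * z))%C with l; [exact Hl|].
  rewrite <- E. field. apply one_minus_cube_neq_0, Hz.
Qed.

Lemma extremal_coefficients f : extremal f -> exists a, ps_on a 1 f /\ a 0%nat = 0%C /\ a 1%nat = 1%C /\
  forall n, convexity_coefficients a n = extremal_convexity n.
Proof.
  intros [HA HE]. destruct (class_A_ps f HA) as (a & Ha & a0 & a1). exists a. repeat split; try assumption.
  apply (ps_on_unique _ _ 1 (fun z => (1 + z * z * z) / (1 - z * z * z))%C Rlt_0_1); [|exact extremal_convexity_ps].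
  intros z Hz. rewrite <- HE by exact Hz. apply (ps_on_z_derivative a 1 f Ha), Hz.
Qed.

Lemma extremal_class_R1 f : extremal f -> class_R1 f.
Proof.
  intros H. destruct (extremal_coefficients f H) as (a & Ha & _). destruct H as [HA HE]. split; [exact HA|].
  intros z Hz. rewrite <- (z_derivativeE a f z Ha Hz), HE by exact Hz. assert (Hn := one_minus_cube_neq_0 z Hz).
  set (w := (z * z * z)%C) in *.
  assert (Hw : Cmod w < 1).
  { unfold w. rewrite !Cmod_mult. pose proof (Cmod_ge_0 z). unfold unit_disc in Hz. assert (Cmod z * Cmod z < 1) by nra. nra. }
  assert (Hpos : 0 < Cmod (1 - w) ^ 2) by (apply pow_lt, Cmod_gt_0, Hn).
  assert (E : Re ((1 + w) / (1 - w))%C = (1 - Cmod w ^ 2) / Cmod (1 - w) ^ 2).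
  { assert (Hn' : Cconj (1 - w)%C <> 0%C).
    { intros E. apply Hn. rewrite <- (Cconj_conj (1 - w)), E. apply Cconj_RtoC. }
    apply Re_eq_of_conj. rewrite RtoC_div by lra. rewrite RtoC_minus, !Cmod_sqr, Cdiv_conj by exact Hn.
    revert Hn'. push_conj. intros Hn'. field. split; assumption. }
  rewrite E. apply Rdiv_lt_0_compat; [|exact Hpos]. pose proof (Cmod_ge_0 w). nra.
Qed.

Lemma extremal_exists : exists f, extremal f.
Proof.
  set (a := fun n => match n return C with O => 0%C | S k => (extremal_convexity k / INR (S k) ^ 2)%C end).
  assert (HI : forall n, (INR (S n) ^ 2)%C <> 0%C).
  { intros n. apply Cpow_nz, RtoC_neq, not_0_INR. lia. }
  assert (HM : forall n, Cmod (a n) * 1 ^ n <= 2).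
  { intros n. rewrite pow1, Rmult_1_r. unfold a. destruct n as [|n]; [rewrite Cmod_0; lra|].
    rewrite Cmod_div by apply HI. rewrite Cmod_pow, Cmod_R, Rabs_pos_eq by apply pos_INR.
    assert (1 <= INR (S n)) by (rewrite S_INR; pose proof (pos_INR n); lra).
    assert (Cmod (extremal_convexity n) <= 2).
    { unfold extremal_convexity. destruct n; [rewrite Cmod_1; lra|].
      destruct (Nat.eq_dec _ 0); rewrite Cmod_R, Rabs_pos_eq; lra. }
    assert (1 <= INR (S n) ^ 2) by nra. apply Rmult_le_reg_r with (INR (S n) ^ 2); [lra|].
    unfold Rdiv. rewrite Rmult_assoc, Rinv_l, Rmult_1_r by lra. nra. }
  assert (Hex : forall z, exists l, Cmod z < 1 -> ps a z l).
  { intros z. destruct (Rlt_dec (Cmod z) 1) as [Hz|Hz]; [|exists 0; tauto].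
    destruct (ps_converges a 2 1 z Rlt_0_1 HM Hz) as [l Hl]. exists l. auto. }
  destruct (functional_choice _ Hex) as [f Hf]. exists f. split.
  - exists a. split; [reflexivity|]. split; [unfold a; simpl; Cfield|]. intros z Hz. apply is_pseries_ps, Hf, Hz.
  - intros z Hz. destruct (ps_on_z_derivative a 1 f Hf) as [H1 _].
    apply (tends_unique _ _ _ (H1 z Hz)).
    refine (ps_ext _ _ _ _ _ (extremal_convexity_ps z Hz)). intros n. unfold convexity_coefficients, a. field. apply RtoC_neq, not_0_INR. lia.
Qed.

Lemma extremal_equality f A : extremal f -> inverse_coefficients f A -> Cmod (Hankel3 A) = 1 / 64.
Proof.
  intros HE (g & r & Hgf & Hr & _ & A0 & A1 & HA).
  destruct (extremal_coefficients f HE) as (a & Ha & a0 & a1 & Hc).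
  rewrite (Hankel3_of_inverse a A f g r); try assumption.
  2: { intros w Hw. apply is_pseries_ps, HA, Hw. }
  assert (E : inverse_hankel (caratheodory_coefficients a) = RtoC (- (1 / 64))).
  { unfold inverse_hankel, caratheodory_coefficients. rewrite !Hc. unfold extremal_convexity; simpl.
    rewrite RtoC_opp, RtoC_div by lra. Cfield. }
  rewrite E, Cmod_R, Rabs_Ropp, Rabs_pos_eq; lra.
Qed.

Theorem theorem2p2 :
  (forall (f : C -> C) (A : nat -> C),
     class_R1 f -> inverse_coefficients f A ->
     Cmod (Hankel3 A) <= 1 / 64)
  /\
  (exists f : C -> C, extremal f)
  /\
  (forall f : C -> C, extremal f ->
     class_R1 f /\
     exists A : nat -> C,
       inverse_coefficients f A /\ Cmod (Hankel3 A) = 1 / 64).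
Proof.
  split; [exact class_R1_bound|]. split; [exact extremal_exists|]. intros f HE.
  assert (HR := extremal_class_R1 f HE). split; [exact HR|].
  destruct (class_R1_inverse f HR) as [A HA]. exists A. split; [exact HA|]. eapply extremal_equality; eassumption.
Qed.
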